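(* Let $n\ge2$ be an integer. For $x\in N_m$ put $$B^{(n)}_m(x):=mx-\frac{2}{(n-1)n^m}G_n(n^mx),$$ and define $P^{(n)}(x):=\lim_{m\to\infty}B_m^{(n)}(x)$ for $x\in N$. Then: (1) If $x\in N_{m_0}$, then $B_m^{(n)}(x)=B_{m_0}^{(n)}(x)$ for every $m\ge m_0$. In particular the limit defining $P^{(n)}$ exists on $N$. (2) $P^{(n)}(0)=P^{(n)}(1)=0$. (3) For every $x_1,\dots,x_n\in N$, with $\bar x=\frac1n\sum_{i=1}^nx_i$, $$P^{(n)}(\bar x)\le\frac1n\sum_{i=1}^nP^{(n)}(x_i)+\frac1n\sum_{i=1}^n|x_i-\bar x|.$$ (4) The function $P^{(n)}$ extends continuously to $[0,1]$ (the extension is still denoted $P^{(n)}$), and $P^{(n)}\in\mathcal B(1,1,n)$. Hence for every measurable set $A\subset[0,1)$, $P^{(n)}(|A|^* )\le\|S_1(\mathbbm 1_A)\|_1$. (5) The continuous extension has the representation $$P^{(n)}(x)=\sum_{j=0}^\infty n^{-j}\eta_n(\{n^jx\}),\qquad 0\le x\le 1,$$ where $\eta_n:[0,1]\to[0,\infty)$ is the continuous function that is linear on each interval $[\rho/n,(\rho+1)/n]$, $0\le\rho\le n-1$, and satisfies $\eta_n(\rho/n)=\frac{\rho(n-\rho)}{n(n-1)}$ for $\rho=0,1,\dots,n$. (6) $P^{(n)}(1-x)=P^{(n)}(x)$ for $0\le x\le1$. (7) For $0<x<1$, $P^{(n)}(x)\asymp_n x^*\log\frac1{x^*}$, where $x^*=\min\{x,1-x\}$;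 i.e. there are constants $0<c\le C<\infty$ depending only on $n$ such that $c\,x^*\log(1/x^* )\le P^{(n)}(x)\le C\,x^*\log(1/x^* )$ for all $x\in(0,1)$.
   Context: $N_m=\{k/n^m:k=0,\dots,n^m\}$ and $N=\bigcup_{m\ge0}N_m$. For an integer $k\ge0$, $\sigma_n(k)$ is the sum of the base-$n$ digits of $k$, and $G_n(M):=\sum_{k=0}^{M-1}\sigma_n(k)$, $G_n(0):=0$. $\{t\}=t-\lfloor t\rfloor$ is the fractional part. $[0,1)$ carries Lebesgue measure, $|A|$ is the Lebesgue measure of $A$, and $|A|^*=\min\{|A|,1-|A|\}$. For $m\ge0$, let $\mathcal I_m=\{[k/n^m,(k+1)/n^m):k=0,\dots,n^m-1\}$ and $\mathcal N_m=\sigma(\mathcal I_m)$. For $f\in L^1[0,1)$ put $f_m=\mathbb E(f\mid\mathcal N_m)$ for $m\ge0$, $d_m=f_m-f_{m-1}$ for $m\ge1$, and $S_1(f)=\sum_{m\ge1}|d_m|$ (value $+\infty$ allowed); $\|\cdot\|_1$ is the $L^1[0,1)$ norm (possibly $+\infty$). $\mathcal B(1,1,n)$ is the family of all continuous functions $F:[0,1]\to[0,\infty)$ with $F(0)=F(1)=0$ such that for every $x_1,\dots,x_n\in[0,1]$, with $\bar x=\frac1n\sum_i x_i$, $$F(\bar x)\le\frac1n\sum_{i=1}^nF(x_i)+\frac1n\sum_{i=1}^n|x_i-\bar x|.$$ *)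

(* Defs.v *)
From HB Require Import structures.
From mathcomp Require Import all_boot all_order all_algebra.
From mathcomp Require Import all_classical all_reals all_analysis.
Set Implicit Arguments.
Unset Strict Implicit.
Unset Printing Implicit Defensive.
Import Order.TTheory GRing.Theory Num.Theory.
Import numFieldNormedType.Exports.
Local Open Scope classical_set_scope.
Local Open Scope ring_scope.

(* For n >= 2 we have k < n ^ k.+1, so the digits of k of index > k vanish. *)
Definition digit_sum (n k : nat) : nat :=
  (\sum_(i < k.+1) (k %/ n ^ i) %% n)%N.

Definition cum_digit_sum (n M : nat) : nat :=
  (\sum_(0 <= k < M) digit_sum n k)%N.

Definition nadic_level (R : realType) (n m : nat) : set R :=
  [set x | exists2 k : nat, (k <= n ^ m)%N & x = k%:R / n%:R ^+ m].
Arguments nadic_level : clear implicits.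

Definition nadic (R : realType) (n : nat) : set R :=
  \bigcup_m nadic_level R n m.
Arguments nadic : clear implicits.

(* Meaningful only for x in nadic_level R n m, where n ^ m x is a natural
   number and truncn is exact; for other x the value is junk. *)
Definition Blevel (R : realType) (n m : nat) (x : R) : R :=
  m%:R * x - 2 / ((n%:R - 1) * n%:R ^+ m)
             * (cum_digit_sum n (Num.truncn (n%:R ^+ m * x)))%:R.

(* For x in nadic_level R n m0, Blevel is junk only at levels m < m0, which do
   not affect the limit. *)
Definition Pnadic (R : realType) (n : nat) (x : R) : R :=
  limn (fun m => Blevel n m x).

Definition mean (R : realType) (n : nat) (x : 'I_n -> R) : R :=
  n%:R^-1 * \sum_(i < n) x i.

Definition mean_ineq (R : realType) (n : nat) (S : set R) (F : R -> R) : Prop :=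
  forall x : 'I_n -> R, (forall i, S (x i)) ->
    F (mean x) <= n%:R^-1 * (\sum_(i < n) F (x i))
                  + n%:R^-1 * (\sum_(i < n) `|x i - mean x|).

(* Functions on [0, 1] are represented by total functions on R of which only
   the restriction to [0, 1] matters. *)
Definition classB11 (R : realType) (n : nat) : set (R -> R) :=
  [set F : R -> R | [/\ {within `[0, 1], continuous F},
               forall x, x \in `[0, 1] -> 0 <= F x,
               F 0 = 0,
               F 1 = 0 &
               mean_ineq n `[0, 1] F]].

Definition star (R : realType) (t : R) : R := Num.min t (1 - t).

Definition fracpart (R : realType) (t : R) : R := t - (Num.floor t)%:~R.

Definition is_eta (R : realType) (n : nat) (eta : R -> R) : Prop :=
  [/\ {within `[0, 1], continuous eta},
      forall t, t \in `[0, 1] -> 0 <= eta t,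
      forall rho : nat, (rho < n)%N -> exists a b : R,
        forall t, t \in `[rho%:R / n%:R, rho.+1%:R / n%:R] ->
          eta t = a * t + b &
      forall rho : nat, (rho <= n)%N ->
        eta (rho%:R / n%:R)
        = rho%:R * (n%:R - rho%:R) / (n%:R * (n%:R - 1))].

(* R with the Lebesgue (not merely Borel) sigma-algebra, on which the complete
   Lebesgue measure is defined. *)
Notation lebesgueType R := (caratheodory_type (R := R) (wlength idfun)^*%mu).

Notation leb := completed_lebesgue_measure.

Definition nadic_itvs (R : realType) (n m : nat) : set (set R) :=
  [set I | exists2 k : nat, (k < n ^ m)%N &
           I = `[k%:R / n%:R ^+ m, k.+1%:R / n%:R ^+ m[%classic].
Arguments nadic_itvs : clear implicits.

Definition nadic_sigma (R : realType) (n m : nat) : set (set R) :=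
  <<s `[0, 1[, nadic_itvs R n m>>.
Arguments nadic_sigma : clear implicits.

(* g is a version of E(f | G), for G a sigma-algebra on [0, 1) and f
   integrable on [0, 1). *)
Definition is_cond_exp (R : realType) (G : set (set R)) (f g : R -> R) : Prop :=
  [/\ forall Y : set R, measurable Y -> G (`[0, 1[ `&` g @^-1` Y),
      (@leb R).-integrable `[0, 1[ (EFin \o g) &
      forall B : set R, G B ->
        (\int[@leb R]_(x in B) (g x)%:E = \int[@leb R]_(x in B) (f x)%:E)%E].

(* A chosen version of E(f | G). *)
Definition cond_exp (R : realType) (G : set (set R)) (f : R -> R) : R -> R :=
  xget (fun=> 0) [set g | is_cond_exp G f g].

Definition mart (R : realType) (n : nat) (f : R -> R) (m : nat) : R -> R :=
  cond_exp (nadic_sigma R n m) f.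

Definition S1 (R : realType) (n : nat) (f : R -> R) (x : R) : \bar R :=
  (\sum_(1 <= m <oo) `|mart n f m x - mart n f m.-1 x|%:E)%E.

Definition norm1 (R : realType) (g : R -> \bar R) : \bar R :=
  (\int[@leb R]_(x in `[0%R, 1%R[) `|g x|)%E.

(* Main.v *)
(* With hump(s) = {s}(1 - {s}) one has eta_n(t) = (n^2 hump(t) - hump(nt)) / (n(n-1)),
   so the series of (5) telescopes to
     P(x) = hump(x)/(n-1) + sum_j n^-j hump(n^j x),
   which is continuous, 1-periodic, even, and satisfies P(x) = P(nx)/n + eta_n(x).
   The same recursion, read on the leading digit, holds for B_m, whence P = B_m on N_m.
   Iterating it also gives (7), since x ln(1/x) obeys it up to the factor ln n.

   On N_m the mean inequality follows from
     G(k_1 + ... + k_n) >= sum_i G(k_i) + sum_(i<j) min(k_i, k_j)   (k_i <= n^m),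
   because |k_i - k_j| <= |k_i - c| + |k_j - c|.  Induction on m: split off the leading
   digits k_i = a_i N + r_i and replace the fractions r_i / N by 0/1 roundings with
   balanced sums; G is affine in these and min is concave, so only k_i <= n remains.
   There the claim says that sum_(i<j) (e_i e_j - min(e_i, e_j)) >= 0 for n integers
   e_i of spread at most n.

   For (4), the mean inequality applied on every n-adic interval gives
     P(|A|) <= E P(f_M) + sum_(m <= M) E |d_m|,
   and E P(f_M) -> 0 since A is nearly a union of n-adic intervals. *)

Require Import Defs.
From HB Require Import structures.
From mathcomp Require Import all_boot all_order all_algebra.
From mathcomp Require Import all_classical all_reals all_analysis.
From mathcomp Require Import measurable_realfun zify ring lra.
Set Implicit Arguments.
Unset Strict Implicit.
Unset Printing Implicit Defensive.
Import Order.TTheory GRing.Theory Num.Theory.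
Import numFieldNormedType.Exports.
Local Open Scope classical_set_scope.
Local Open Scope ring_scope.

(** * A quadratic inequality for integers of small spread *)

(* Twice the sum of x * y - min x y over the unordered pairs of entries of s. *)
Definition pair_defect (s : seq int) : int :=
  \sum_(x <- s) \sum_(y <- s) (x * y - Num.min x y) - \sum_(x <- s) (x * x - x).

Lemma perm_pair_defect s t : perm_eq s t -> pair_defect s = pair_defect t.
Proof.
move=> st; rewrite /pair_defect (perm_big _ st) [X in _ - X](perm_big _ st) /=.
by congr (_ - _); apply: eq_bigr => x _; apply: perm_big.
Qed.

Lemma pair_defect_cons x s :
  pair_defect (x :: s)
  = pair_defect s + 2 * \sum_(y <- s) (x * y - Num.min x y).
Proof.
rewrite /pair_defect !big_cons minxx.
have -> : \sum_(z <- s) \sum_(y <- x :: s) (z * y - Num.min z y)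
  = \sum_(y <- s) (x * y - Num.min x y)
    + \sum_(z <- s) \sum_(y <- s) (z * y - Num.min z y).
  rewrite -big_split; apply: eq_bigr => z _.
  by rewrite big_cons mulrC minC.
ring.
Qed.

(** A largest entry [x] has min(x, y) = y in each new pair, so the sign of its contribution depends
    only on [x] and the sum of the other entries. *)
Lemma pair_defect_cons_max x s : {in s, forall y, y <= x} ->
  pair_defect (x :: s) = pair_defect s + 2 * ((x - 1) * \sum_(y <- s) y).
Proof.
move=> sx; rewrite pair_defect_cons [(x - 1) * _]mulr_sumr; congr (_ + 2 * _).
rewrite big_seq [RHS]big_seq; apply: eq_bigr => y ys.
by rewrite min_r ?sx//; ring.
Qed.

Lemma pair_defect_cons_min x s : {in s, forall y, x <= y} ->
  pair_defect (x :: s)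
  = pair_defect s + 2 * (x * (\sum_(y <- s) y - (size s)%:Z)).
Proof.
move=> sx; rewrite pair_defect_cons; congr (_ + 2 * _).
rewrite mulrBr mulr_sumr.
have -> : x * (size s)%:Z = \sum_(y <- s) x.
  by rewrite big_const_seq count_predT iter_addr_0 -mulr_natr natz.
rewrite -sumrB big_seq [RHS]big_seq; apply: eq_bigr => y ys.
by rewrite min_l ?sx.
Qed.

(** Shifting a pair by 1 changes xy - min(x, y) by x + y, and each entry lies in [size s - 1]
    pairs. *)
Lemma pair_defect_shift s :
  pair_defect [seq x + 1 | x <- s]
  = pair_defect s + 2 * (((size s)%:Z - 1) * \sum_(y <- s) y).
Proof.
elim: s => [|x s IHs]; first by rewrite /pair_defect /= !big_nil; ring.
rewrite map_cons !pair_defect_cons IHs big_map big_cons /=.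
have -> : \sum_(y <- s) ((x + 1) * (y + 1) - Num.min (x + 1) (y + 1))
  = \sum_(y <- s) (x * y - Num.min x y) + (x * (size s)%:Z + \sum_(y <- s) y).
  have -> : x * (size s)%:Z = \sum_(y <- s) x.
    by rewrite big_const_seq count_predT iter_addr_0 -mulr_natr natz.
  rewrite -!big_split /=; apply: eq_bigr => y _.
  by rewrite -addr_minl; ring.
by rewrite intS; ring.
Qed.

(** Every pair already contributes a nonnegative amount: for nonnegative integers either the minimum
    is 0 or the larger factor is at least 1, and for nonpositive ones xy >= 0 >= min(x, y). *)
Lemma pair_defect_ge0_same_sign s :
  {in s, forall x, 0 <= x} \/ {in s, forall x, x <= 0} -> 0 <= pair_defect s.
Proof.
elim: s => [|x s IHs]; first by rewrite /pair_defect !big_nil.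
move=> sgn; rewrite pair_defect_cons addr_ge0 ?IHs//.
  case: sgn => sgn; [left|right] => y ys; apply: sgn; by rewrite inE ys orbT.
rewrite mulr_ge0// big_seq sumr_ge0// => y ys.
case: sgn => sgn;
  have := sgn x (mem_head _ _); have := sgn y; rewrite inE ys orbT => /(_ isT).
- by move=> y0 x0; case: (leP x y) => xy; nia.
- by move=> y0 x0; case: (leP x y) => xy; nia.
Qed.

Lemma seq_max_mem (s : seq int) : s != [::] ->
  exists2 x : int, x \in s & {in s, forall y, y <= x}.
Proof.
elim: s => // x [|y s] IHs _.
  by exists x; rewrite ?mem_head// => y; rewrite inE => /eqP->.
have [z zs zmax] := IHs isT.
have [xz|zx] := leP x z.
  exists z; first by rewrite inE zs orbT.
  by move=> w; rewrite inE => /predU1P[->//|]; exact: zmax.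
exists x; first exact: mem_head.
move=> w; rewrite inE => /predU1P[->//|/zmax wz].
exact: le_trans wz (ltW zx).
Qed.

Lemma seq_min_mem (s : seq int) : s != [::] ->
  exists2 x : int, x \in s & {in s, forall y, x <= y}.
Proof.
move=> s0; have [] := @seq_max_mem [seq - x | x <- s]; first by case: s s0.
move=> _ /mapP[x xs ->] xmax; exists x => // y ys.
by have := xmax (- y) (map_f _ ys); rewrite lerN2.
Qed.

(** Outer induction on the length, inner induction on the number of entries at the upper end of the
    window. The inner induction lowers the spread by one; then the removal of any entry leaves a
    list to which the outer hypothesis applies, and either the maximum or the minimum can be removed
    without increasing the defect. *)
Lemma pair_defect_ge0 (s : seq int) (m : int) :
  {in s, forall x, m <= x <= m + (size s)%:Z} -> 0 <= pair_defect s.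
Proof.
move: {2}(size s) (erefl (size s)) => n; elim: n s m => [|n IHn] s m sz.
  by move/size0nil: sz => ->; rewrite /pair_defect !big_nil.
rewrite sz; move: {2}(count_mem (m + n.+1%:Z) s)
  (leqnn (count_mem (m + n.+1%:Z) s)) => c.
elim: c s m sz => [|c IHc] s m sz hc hs; last first.
  (* Replacing a maximum M by M - (size s) and shifting by 1 leaves the
     defect unchanged. *)
  have [/count_memPn c0|/negbNE Ms] := boolP (m + n.+1%:Z \notin s).
    by apply: (IHc s m) => //; rewrite c0.
  have sM := perm_to_rem Ms; set s' := rem _ s in sM.
  have szs' : size s' = n by rewrite size_rem// sz.
  have s's x : x \in s' -> m <= x <= m + n.+1%:Z by move/mem_rem/hs.
  rewrite (perm_pair_defect sM) pair_defect_cons_max; last first.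
    by move=> y /s's /andP[].
  suff : 0 <= pair_defect [seq x + 1 | x <- m :: s'].
    rewrite pair_defect_shift pair_defect_cons_min; last by move=> y /s's/andP[].
    rewrite big_cons /= szs'; congr (_ <= _).
    by rewrite intS; ring.
  apply: (IHc _ (m + 1)); first by rewrite size_map /= szs'.
    move: hc; rewrite (seq.permP sM) /= eqxx add1n ltnS => hc.
    rewrite count_map.
    rewrite (_ : (_ == _) = false) ?add0n; last by apply/negbTE; lia.
    by rewrite (@eq_count _ _ (pred1 (m + n.+1%:Z))) // => x /=; lia.
  by move=> x /mapP[y]; rewrite inE => /predU1P[-> ->|/s's hy ->]; lia.
(* No entry sits at the upper end any more, so the spread is at most [n], the length after one
   removal. *)
have {hc}hs x : x \in s -> m <= x <= m + n%:Z.
  move=> xs; have := hs x xs; have : x != m + n.+1%:Z; last lia.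
  by apply: contraTneq xs => ->; apply/count_memPn/eqP; rewrite -leqn0.
have s0 : s != [::] by case: s sz {hs}.
have [M Ms Mmax] := seq_max_mem s0.
have [m0 ms mmin] := seq_min_mem s0.
have [m0ge|m0lt] := leP 0 m0.
  apply: pair_defect_ge0_same_sign; left => x /mmin; exact: le_trans.
have [Mle|Mgt] := leP M 0.
  by apply: pair_defect_ge0_same_sign; right => x /Mmax xM; exact: le_trans Mle.
have IHrem x : x \in s -> 0 <= pair_defect (rem x s).
  move=> xs; have szr : size (rem x s) = n by rewrite size_rem// sz.
  by apply: (IHn _ m) => // y; rewrite szr => /mem_rem/hs.
have sumE (x : int) : x \in s -> \sum_(y <- s) y = x + \sum_(y <- rem x s) y.
  by move=> xs; rewrite (perm_big _ (perm_to_rem xs)) big_cons.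
(* Here [m0] < 0 < [M]. If the total is at least [M], the pairs containing [M] contribute (M -
   1)(total - M) >= 0. Otherwise the entries other than [m0] sum to less than M - m0 <= n, so the
   pairs containing [m0] contribute a product of two nonpositive factors. *)
have [rM|rM] := leP M (\sum_(y <- s) y).
  rewrite (perm_pair_defect (perm_to_rem Ms)) pair_defect_cons_max; last first.
    by move=> y /mem_rem /Mmax.
  rewrite addr_ge0 ?IHrem// mulr_ge0// mulr_ge0//; first lia.
  by move: rM; rewrite (sumE _ Ms) lerDl.
rewrite (perm_pair_defect (perm_to_rem ms)) pair_defect_cons_min; last first.
  by move=> y /mem_rem /mmin.
rewrite addr_ge0 ?IHrem// mulr_ge0// mulr_le0 ?(ltW m0lt)//.
rewrite size_rem// sz /=; move: rM; rewrite (sumE _ ms).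
have := hs _ Ms; have := hs _ ms.
by move: (\sum_(y <- rem m0 s) y) => S; lia.
Qed.

(** * Digit sums *)

Section DigitSums.
Local Open Scope nat_scope.

Lemma digit_sum_widen n m k : 1 < n -> k < n ^ m ->
  digit_sum n k = \sum_(i < m) (k %/ n ^ i) %% n.
Proof.
move=> n1 km; have kk : k < n ^ k.+1.
  by rewrite (ltn_trans (ltn_expl k n1))// ltn_exp2l.
have aux p : k < n ^ p -> forall q, p <= q ->
    \sum_(i < q) (k %/ n ^ i) %% n = \sum_(i < p) (k %/ n ^ i) %% n.
  move=> kp q pq; rewrite -!(big_mkord xpredT (fun i => (k %/ n ^ i) %% n)).
  rewrite (big_cat_nat (n := p))//= [X in _ + X]big_nat.
  rewrite [X in _ + X]big1 ?addn0// => i /andP[pi _].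
  by rewrite divn_small ?mod0n// (leq_trans kp)// leq_exp2l.
by rewrite /digit_sum -(aux _ kk _ (leq_maxl _ m)) (aux _ km)// leq_maxr.
Qed.

Lemma digit_sum_cons n q r : 1 < n -> r < n ->
  digit_sum n (q * n + r) = digit_sum n q + r.
Proof.
move=> n1 rn; have n0 : 0 < n by exact: ltnW.
have qq : q < n ^ q.+1 by rewrite (ltn_trans (ltn_expl q n1))// ltn_exp2l.
have H : q * n + r < n ^ q.+2.
  apply: (@leq_trans (q.+1 * n)); first by rewrite mulSn; lia.
  by rewrite expnSr leq_mul2r qq orbT.
rewrite (digit_sum_widen n1 H) big_ord_recl expn0 divn1 modnMDl modn_small// addnC.
congr (_ + _); rewrite /digit_sum; apply: eq_bigr => i _.
by rewrite lift0 expnS divnMA divnMDl// (divn_small rn) addn0.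
Qed.

Lemma digit_sum0 n : digit_sum n 0 = 0.
Proof. by rewrite /digit_sum big_ord1 div0n mod0n. Qed.

Lemma digit_sum_small n r : 1 < n -> r < n -> digit_sum n r = r.
Proof.
by move=> n1 rn; have := digit_sum_cons 0 n1 rn; rewrite mul0n add0n digit_sum0.
Qed.

Lemma digit_sumD n m a r : 1 < n -> r < n ^ m ->
  digit_sum n (a * n ^ m + r) = digit_sum n a + digit_sum n r.
Proof.
move=> n1; have n0 : 0 < n by exact: ltnW.
elim: m r => [|m IHm] r.
  by rewrite expn0 ltnS leqn0 => /eqP->; rewrite muln1 digit_sum0 !addn0.
rewrite expnSr => rm; rewrite {1}(divn_eq r n) mulnA addnA -mulnDl.
rewrite digit_sum_cons ?ltn_mod// IHm ?ltn_divLR//.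
by rewrite {3}(divn_eq r n) digit_sum_cons ?ltn_mod// addnA.
Qed.

Lemma cum_digit_sum0 n : cum_digit_sum n 0 = 0.
Proof. by rewrite /cum_digit_sum big_geq. Qed.

Lemma cum_digit_sumS n M :
  cum_digit_sum n M.+1 = cum_digit_sum n M + digit_sum n M.
Proof. by rewrite /cum_digit_sum big_nat_recr. Qed.

Lemma cum_digit_sum_small n b : 1 < n -> b <= n -> cum_digit_sum n b = 'C(b, 2).
Proof.
move=> n1; elim: b => [|b IHb] bn; first by rewrite cum_digit_sum0.
by rewrite cum_digit_sumS IHb 1?ltnW// digit_sum_small// binS bin1.
Qed.

(** The range splits into [a] full blocks of length n^m and a partial one, and on block b every
    digit sum is raised by the digit sum of b. The case r = n^m is included so that right endpoints
    of intervals can be treated like the other points. *)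
Lemma cum_digit_sum_digit n m a r : 1 < n -> r <= n ^ m ->
  cum_digit_sum n (a * n ^ m + r)
  = n ^ m * cum_digit_sum n a + a * cum_digit_sum n (n ^ m)
    + r * digit_sum n a + cum_digit_sum n r.
Proof.
move=> n1; have H b t : t <= n ^ m -> cum_digit_sum n (b * n ^ m + t)
    = cum_digit_sum n (b * n ^ m) + t * digit_sum n b + cum_digit_sum n t.
  elim: t => [|t IHt] tm; first by rewrite cum_digit_sum0 mul0n !addn0.
  by rewrite addnS !cum_digit_sumS IHt 1?ltnW// digit_sumD//; lia.
move=> rm; rewrite H//; congr (_ + _ + _).
elim: a => [|a IHa]; first by rewrite !mul0n cum_digit_sum0 muln0.
by rewrite mulSnr H// IHa cum_digit_sumS; lia.
Qed.

(** Moving the window of length [N] one step to the right drops its first term and gains the value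
    of [f] at (a + N) div N = a div N + 1. *)
Lemma sum_div_shiftS (f : nat -> nat) N a : 0 < N ->
  \sum_(s < N) f ((a.+1 + s) %/ N) + f (a %/ N)
  = \sum_(s < N) f ((a + s) %/ N) + f (a %/ N).+1.
Proof.
case: N => // N _; rewrite [in LHS]big_ord_recr [in RHS]big_ord_recl /= addn0.
rewrite (_ : a.+1 + N = a + N.+1); last lia.
rewrite divnDr// divnn addn1 [LHS]addnAC; congr (_ + _).
by rewrite addnC; congr (_ + _); apply: eq_bigr => s _; rewrite ?/bump ?leq0n ?add1n addSnnS.
Qed.

(** With N = n^m and X = qN + r, the sum over s is (N - r)G(q) + rG(q + 1), that is, N times the
    linear interpolation of G at X / N. Written with (X + s) div N it matches the totals of the
    balanced roundings in [exists_rounding]. *)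
Lemma cum_digit_sum_split n m X : 1 < n ->
  cum_digit_sum n X = \sum_(s < n ^ m) cum_digit_sum n ((X + s) %/ n ^ m)
    + X %/ n ^ m * cum_digit_sum n (n ^ m) + cum_digit_sum n (X %% n ^ m).
Proof.
move=> n1; set N := n ^ m; have N0 : 0 < N by rewrite expn_gt0 ltnW.
elim: X => [|X IHX].
  rewrite div0n mod0n !cum_digit_sum0 big1// => s _.
  by rewrite add0n divn_small// cum_digit_sum0.
have sumS : \sum_(s < N) cum_digit_sum n ((X.+1 + s) %/ N)
    = \sum_(s < N) cum_digit_sum n ((X + s) %/ N) + digit_sum n (X %/ N).
  have := sum_div_shiftS (cum_digit_sum n) X N0.
  by rewrite cum_digit_sumS; lia.
rewrite cum_digit_sumS IHX sumS.
have mX : X %% N < N by rewrite ltn_mod.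
have -> : digit_sum n X = digit_sum n (X %/ N) + digit_sum n (X %% N).
  by rewrite -(digit_sumD _ n1 mX) -divn_eq.
have [lt|] := ltnP (X %% N).+1 N.
  have -> : X.+1 %/ N = X %/ N.
    by rewrite [in LHS](divn_eq X N) -addnS divnMDl// (divn_small lt) addn0.
  have -> : X.+1 %% N = (X %% N).+1.
    by rewrite [in LHS](divn_eq X N) -addnS modnMDl modn_small.
  by rewrite cum_digit_sumS; lia.
move=> ge; have eqN : (X %% N).+1 = N by apply/eqP; rewrite eqn_leq mX ge.
have -> : X.+1 %/ N = (X %/ N).+1.
  by rewrite [in LHS](divn_eq X N) -addnS eqN divnMDl// divnn N0 addn1.
have -> : X.+1 %% N = 0.
  by rewrite [in LHS](divn_eq X N) -addnS eqN modnMDl modnn.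
have GN : cum_digit_sum n N
    = cum_digit_sum n (X %% N) + digit_sum n (X %% N).
  by rewrite -cum_digit_sumS eqN.
by rewrite cum_digit_sum0 mulSn {2}GN; lia.
Qed.

(** * Superadditivity of cumulative digit sums *)

Lemma sum_sumM n (e : nat -> nat) :
  \sum_(i < n) \sum_(j < n) e i * e j = (\sum_(i < n) e i) * (\sum_(i < n) e i).
Proof.
by rewrite big_distrl; apply: eq_bigr => i _; rewrite big_distrr.
Qed.

Lemma double_bin2 b : 2 * 'C(b, 2) + b = b * b.
Proof. by elim: b => // b IHb; rewrite binS bin1; nia. Qed.

(* Doubled form: the double sum of minn counts each pair twice and the diagonal
   once. *)
Lemma cum_digit_sum_superadd_small n (b : nat -> nat) : 1 < n ->
  (forall i, i < n -> b i <= n) ->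
  2 * \sum_(i < n) 'C(b i, 2) + \sum_(i < n) \sum_(j < n) minn (b i) (b j)
  <= 2 * cum_digit_sum n (\sum_(i < n) b i) + \sum_(i < n) b i.
Proof.
move=> n1 bn; have n0 : 0 < n by exact: ltnW.
set B := \sum_(i < n) b i.
have Bnn : B <= n * n.
  rewrite -[X in _ <= X * _](card_ord n) -sum_nat_const leq_sum// => i _.
  exact: bn.
set q := B %/ n; set r := B %% n.
have Bqr : B = q * n + r by exact: divn_eq.
have rn : r < n by rewrite ltn_mod.
have qn : q <= n by rewrite -(mulnK n n0) leq_div2r.
have sumZ (f : 'I_n -> nat) :
    ((\sum_(i < n) f i)%N%:Z = \sum_(i < n) (f i)%:Z :> int)%R.
  by rewrite -natz natr_sum; apply: eq_bigr => i _; rewrite natz.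
(* Centering at the integer part [q] of the mean puts the entries in [-q, n - q], a window of width
   n, and makes their sum the remainder [r]. *)
pose e i : int := ((b i)%:Z - q%:Z)%R.
have : (0 <= pair_defect (mkseq e n))%R.
  apply: (@pair_defect_ge0 _ (- q%:Z)%R); rewrite size_mkseq.
  by move=> _ /mapP[i] + ->; rewrite mem_iota /e => /bn; lia.
have bigE (F : int -> int) : (\sum_(x <- mkseq e n) F x = \sum_(i < n) F (e i))%R.
  by rewrite big_map -{1}(subn0 n) -/(index_iota 0 n) big_mkord.
rewrite /pair_defect !bigE; under eq_bigr do rewrite bigE.
have -> : (\sum_(i < n) \sum_(j < n) (e i * e j - Num.min (e i) (e j)) =
   (\sum_(i < n) e i) * (\sum_(i < n) e i)
    - (\sum_(i < n) \sum_(j < n) minn (b i) (b j))%N%:Z + n%:Z * n%:Z * q%:Z)%R.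
  rewrite big_distrl/= sumZ.
  have -> : (n%:Z * n%:Z * q%:Z = \sum_(i < n) \sum_(j < n) q%:Z :> int)%R.
    under eq_bigr do rewrite sumr_const card_ord.
    by rewrite sumr_const card_ord -mulrnA -mulr_natr natz; lia.
  rewrite -sumrB -big_split; apply: eq_bigr => i _ /=.
  rewrite sumZ big_distrr/= -sumrB -big_split; apply: eq_bigr => j _ /=.
  by rewrite /e; lia.
have -> : (\sum_(i < n) e i = r%:Z)%R.
  rewrite /e sumrB sumr_const card_ord.
  have -> : (\sum_(i < n) (b i)%:Z = B%:Z)%R.
    by rewrite /B sumZ.
  by rewrite Bqr -mulr_natr natz; lia.
have -> : (\sum_(i < n) (e i * e i - e i) = 2 * (\sum_(i < n) 'C(b i, 2))%N%:Z
   - 2 * q%:Z * B%:Z + n%:Z * (q%:Z * q%:Z + q%:Z))%R.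
  have -> : (n%:Z * (q%:Z * q%:Z + q%:Z)
      = \sum_(i < n) (q%:Z * q%:Z + q%:Z) :> int)%R.
    by rewrite sumr_const card_ord -mulr_natl natz; lia.
  rewrite /B !sumZ !big_distrr/= -sumrB -big_split; apply: eq_bigr => i _ /=.
  by have := double_bin2 (b i); rewrite /e; lia.
have GB : cum_digit_sum n B = n * 'C(q, 2) + q * 'C(n, 2) + r * q + 'C(r, 2).
  rewrite Bqr -[X in q * X + r]expn1 cum_digit_sum_digit ?expn1 ?(ltnW rn)//.
  rewrite !cum_digit_sum_small ?(ltnW rn)//.
  (* The quotient [q] may equal n, where it is not a digit; but then B = n * n and r = 0. *)
  suff -> : r * digit_sum n q = r * q by [].
  have [qlt|] := ltnP q n; first by rewrite digit_sum_small.
  by move=> nq; have -> : r = 0; [nia|rewrite !mul0n].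
rewrite GB.
have := double_bin2 q; have := double_bin2 r; have := double_bin2 n.
move: ('C(q, 2)) ('C(r, 2)) ('C(n, 2)) => c1 c2 c3.
move: (\sum_(i < n) \sum_(j < n) minn _ _) (\sum_(i < n) 'C(b i, 2)) => S1 S2.
move=> H1 H2 H3 H.
suff : (0 <= 2 * (2 * (n * c1 + q * c3 + r * q + c2) + B)%N%:Z
    - 2 * (2 * S2 + S1)%N%:Z :> int)%R by lia.
lia.
Qed.

Lemma sum_div_shift N a : 0 < N -> \sum_(s < N) (a + s) %/ N = a.
Proof.
move=> N0; elim: a => [|a IHa].
  by apply: big1 => s _; rewrite add0n divn_small.
by have := sum_div_shiftS id a N0; rewrite IHa /=; lia.
Qed.

(* Systematic sampling: the s-th rounding of (r_i / N)_i takes the increments of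
   the rounded partial sums, so all its sums are balanced. *)
Lemma exists_rounding n N (r : nat -> nat) : 0 < N ->
  (forall i, i < n -> r i <= N) ->
  exists e : nat -> nat -> nat,
    [/\ forall i s, i < n -> e i s <= 1,
        forall i, \sum_(s < N) e i s = r i &
        forall s, s < N -> \sum_(i < n) e i s = (\sum_(i < n) r i + s) %/ N].
Proof.
move=> N0 rN; pose p i := \sum_(0 <= j < i) r j.
have pS i : p i.+1 = p i + r i by rewrite /p big_nat_recr.
pose e i s := (p i.+1 + s) %/ N - (p i + s) %/ N.
have eE i s : (p i + s) %/ N + e i s = (p i.+1 + s) %/ N.
  by rewrite /e subnKC// leq_div2r// pS; lia.
exists e; split => [i s /rN rNi|i|s sN].
- have pN : (p i + s + N) %/ N = (p i + s) %/ N + 1 by rewrite divnDr// divnn N0.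
  by rewrite /e leq_subLR -pN leq_div2r// pS; lia.
- apply: (@addnI (p i)); rewrite -pS -{1}(sum_div_shift (p i) N0) -big_split /=.
  by rewrite -[RHS](sum_div_shift _ N0); apply: eq_bigr => s _; exact: eE.
- have H m : \sum_(i < m) e i s = (p m + s) %/ N.
    elim: m => [|m IHm]; last by rewrite big_ord_recr /= IHm eE.
    by rewrite big_ord0 /p big_geq// add0n divn_small.
  by rewrite H /p big_mkord.
Qed.

(** Doubled form of G(k_1 + ... + k_n) >= sum G(k_i) + sum over i < j of min(k_i, k_j); the diagonal
    of the double sum accounts for the term sum k_i on the right. In the induction on [m] the
    leading digits meet N = n^m balanced 0/1 roundings of the remainders, each of which falls under
    the small case. *)
Lemma cum_digit_sum_superadd n m (k : nat -> nat) : 1 < n ->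
  (forall i, i < n -> k i <= n ^ m) ->
  2 * \sum_(i < n) cum_digit_sum n (k i)
    + \sum_(i < n) \sum_(j < n) minn (k i) (k j)
  <= 2 * cum_digit_sum n (\sum_(i < n) k i) + \sum_(i < n) k i.
Proof.
move=> n1; have n0 : 0 < n by exact: ltnW.
elim: m k => [|m IHm] k kn.
  have k1 i : i < n -> k i <= n by move=> /kn /leq_trans; apply; rewrite expn0.
  apply: leq_trans (cum_digit_sum_superadd_small n1 k1); rewrite leq_add2r leq_mul2l /=.
  by apply: leq_sum => i _; rewrite cum_digit_sum_small// k1.
set N := n ^ m in kn *; have N0 : 0 < N by rewrite expn_gt0 n0.
(* For k_i = nN the leading part is n - 1 and the remainder is the full N, so that [a i] stays a
   digit and a_i + e_i <= n. *)
pose a i := if k i < n * N then k i %/ N else n.-1.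
pose r i := if k i < n * N then k i %% N else N.
have rN i : r i <= N by rewrite /r; case: ifP => // _; rewrite ltnW// ltn_mod.
have an i : i < n -> a i < n.
  by move=> _; rewrite /a; case: ifP => [|_]; [rewrite ltn_divLR|rewrite prednK].
have kE i : i < n -> k i = a i * N + r i.
  move=> /kn; rewrite expnS -/N /a /r; case: ltnP => [_ _|nk kn'].
    exact: divn_eq.
  have -> : k i = n * N by apply/eqP; rewrite eqn_leq kn'.
  by rewrite -{1}(prednK n0) mulSn addnC.
have [e [e1 sume sumE]] := exists_rounding N0 (fun i (_ : i < n) => rN i).
(* Equality holds if a_i = a_j. If a_i < a_j, then k_i and every rounding a_i + e_i are the minima,
   so the sums of those agree, and what remains is that the sum of min(e_i, e_j) is at most min(r_i,
   r_j). *)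
have pair i j : i < n -> j < n ->
    minn (k i) (k j) + \sum_(s < N) minn (e i s) (e j s)
    <= \sum_(s < N) minn (a i + e i s) (a j + e j s) + minn (r i) (r j).
  move=> iN jN; wlog aij : i j iN jN / a i <= a j => [wl|].
    have [/(wl _ _ iN jN)//|/ltnW/(wl _ _ jN iN)] := leqP (a i) (a j).
    rewrite [minn (k j) _]minnC [minn (r j) _]minnC.
    under eq_bigr do rewrite minnC.
    by under [X in _ <= X + _]eq_bigr do rewrite minnC.
  have minE : \sum_(s < N) minn (e i s) (e j s) <= minn (r i) (r j).
    rewrite leq_min -!sume; apply/andP.
    by split; apply: leq_sum => s _; [exact: geq_minl|exact: geq_minr].
  have [aE|alt] := eqVneq (a i) (a j).
    under [X in _ <= X + _]eq_bigr do rewrite aE -addn_minr.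
    rewrite big_split /= sum_nat_const card_ord !kE// aE -addn_minr; lia.
  have {}alt : a i < a j by rewrite ltn_neqAle alt.
  under [X in _ <= X + _]eq_bigr => s _.
    rewrite (minn_idPl _); last first.
      rewrite (leq_trans _ (leq_addr _ _))// (leq_trans _ alt)//.
      by rewrite -addn1 leq_add2l e1.
    over.
  rewrite big_split /= sum_nat_const card_ord sume (minn_idPl _).
    by rewrite kE// [N * _]mulnC leq_add2l.
  rewrite !kE// (@leq_trans ((a i).+1 * N))//.
    by rewrite mulSn addnC leq_add2r.
  by rewrite (leq_trans _ (leq_addr _ _))// leq_mul2r alt orbT.
have vert s : s < N ->
    2 * \sum_(i < n) 'C(a i + e i s, 2)
      + \sum_(i < n) \sum_(j < n) minn (a i + e i s) (a j + e j s)
    <= 2 * cum_digit_sum n (\sum_(i < n) a i + (\sum_(i < n) r i + s) %/ N)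
       + \sum_(i < n) a i + (\sum_(i < n) r i + s) %/ N.
  move=> sN; have := @cum_digit_sum_superadd_small n (fun i => a i + e i s) n1.
  rewrite !big_split /= sumE// addnA; apply => i iN.
  by have := an _ iN; have := e1 _ s iN; lia.
pose A := \sum_(i < n) a i; pose S := \sum_(i < n) r i.
pose E s := (S + s) %/ N; pose G := cum_digit_sum n.
have KE : \sum_(i < n) k i = A * N + S.
  rewrite /A big_distrl /= -big_split; apply: eq_bigr => i _; exact: kE.
have GE : \sum_(i < n) G (k i) = N * \sum_(i < n) 'C(a i, 2) + A * G N
    + \sum_(i < n) a i * r i + \sum_(i < n) G (r i).
  rewrite big_distrr [A * _]big_distrl -!big_split /=; apply: eq_bigr => i _.
  rewrite kE// /G cum_digit_sum_digit// (cum_digit_sum_small n1 (ltnW (an _ _)))//.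
  by rewrite digit_sum_small ?an// [r i * _]mulnC.
(* A N + S and S have the same remainder modulo N, so the low-order terms of the two splittings
   cancel. *)
have GK : G (A * N + S) + \sum_(s < N) G (E s)
    = \sum_(s < N) G (A + E s) + A * G N + G S.
  rewrite /G (cum_digit_sum_split m (A * N + S) n1) [in RHS](cum_digit_sum_split m S n1).
  rewrite -/N divnMDl// modnMDl mulnDl.
  under eq_bigr do rewrite -addnA divnMDl//.
  rewrite /E /= -!addnA; congr (_ + (_ + _)).
  by rewrite addnA addnC.
(* For 0/1 entries the small case is an equality: 2 C(E, 2) + E = E^2, and e_i e_j = min(e_i,
   e_j). *)
have GEs s : s < N ->
    2 * G (E s) + E s = \sum_(i < n) \sum_(j < n) minn (e i s) (e j s).
  move=> sN; have En : E s <= n.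
    rewrite /E -sumE// -[X in _ <= X]muln1 -[X in _ <= X * _](card_ord n).
    by rewrite -sum_nat_const leq_sum// => i _; exact: e1.
  rewrite /G cum_digit_sum_small// double_bin2 /E -sumE// -(sum_sumM n (e^~ s)).
  apply: eq_bigr => i _; apply: eq_bigr => j _.
  by have := e1 i s (ltn_ord i); have := e1 j s (ltn_ord j); nia.
have sumES : \sum_(s < N) E s = S by exact: sum_div_shift.
have sumbin : \sum_(s < N) \sum_(i < n) 'C(a i + e i s, 2)
    = N * \sum_(i < n) 'C(a i, 2) + \sum_(i < n) a i * r i.
  rewrite exchange_big big_distrr -big_split /=; apply: eq_bigr => i _.
  rewrite -(sume i) big_distrr /= -[X in X * _](card_ord N) -sum_nat_const.
  rewrite -big_split /=; apply: eq_bigr => s _.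
  have := double_bin2 (a i); have := double_bin2 (a i + e i s).
  have := e1 i s (ltn_ord i); nia.
have pairs : \sum_(i < n) \sum_(j < n) minn (k i) (k j)
    + \sum_(s < N) \sum_(i < n) \sum_(j < n) minn (e i s) (e j s)
    <= \sum_(s < N) \sum_(i < n) \sum_(j < n) minn (a i + e i s) (a j + e j s)
      + \sum_(i < n) \sum_(j < n) minn (r i) (r j).
  do 2 (rewrite [\sum_(s < N) _]exchange_big /=).
  rewrite -!big_split /=; apply: leq_sum => i _.
  do 2 (rewrite [\sum_(s < N) _]exchange_big /=).
  by rewrite -!big_split /=; apply: leq_sum => j _; exact: pair.
have verts : 2 * \sum_(s < N) \sum_(i < n) 'C(a i + e i s, 2)
    + \sum_(s < N) \sum_(i < n) \sum_(j < n) minn (a i + e i s) (a j + e j s)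
    <= 2 * \sum_(s < N) G (A + E s) + N * A + S.
  rewrite -sumES -[X in X * A](card_ord N) -sum_nat_const !big_distrr -!big_split /=.
  by apply: leq_sum => s _; exact: vert.
rewrite sumbin in verts.
have {}GEs : 2 * \sum_(s < N) G (E s) + S
    = \sum_(s < N) \sum_(i < n) \sum_(j < n) minn (e i s) (e j s).
  rewrite -{1}sumES big_distrr -big_split /=.
  by apply: eq_bigr => s _; exact: GEs.
(* The claim is now a linear combination of [verts], [pairs] and the hypothesis for the remainders;
   the terms in the 0/1 roundings cancel through [GEs]. *)
have := IHm r (fun i _ => rN i); rewrite -/G -/S -/A KE GE.
move: pairs verts GK GEs.
move: (\sum_(s < N) \sum_(i < n) \sum_(j < n) _) (\sum_(s < N) \sum_(i < n) \sum_(j < n) _).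
move: (\sum_(i < n) \sum_(j < n) minn (k i) (k j)) (\sum_(i < n) \sum_(j < n) minn (r i) (r j)).
move: (\sum_(s < N) G (E s)) (\sum_(s < N) G (A + E s)) (\sum_(i < n) 'C(a i, 2)).
move: (\sum_(i < n) a i * r i) (\sum_(i < n) G (r i)) (G N) (G S) (G (A * N + S)).
move=> z1 z2 z3 z4 z5 z6 z7 z8 z9 z10 z11 z12.
lia.
Qed.

End DigitSums.

(** * The continuous extension *)

Definition hump (R : realType) (s : R) : R := fracpart s * (1 - fracpart s).

Lemma fracpart_itv (R : realType) (s : R) : 0 <= fracpart s < 1.
Proof.
have := lt_succ_floor s; have := ge_floor s.
by rewrite /fracpart intrD; lra.
Qed.

(** The closed right end is admissible because the parabola vanishes there as well; later case
    distinctions can therefore use closed intervals. *)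
Lemma humpE (R : realType) (s : R) (a : int) : a%:~R <= s <= a%:~R + 1 ->
  hump s = (s - a%:~R) * (1 - (s - a%:~R)).
Proof.
move=> /andP[as1]; rewrite le_eqVlt => /predU1P[->|sa].
  have -> : a%:~R + 1 = (a + 1)%:~R :> R by rewrite intrD.
  by rewrite /hump /fracpart intrKfloor intrD; ring.
rewrite /hump /fracpart (_ : Num.floor s = a)//.
by apply: floor_def; rewrite as1 intrD.
Qed.

Lemma humpE_nat (R : realType) (s : R) (a : nat) : a%:R <= s <= a%:R + 1 ->
  hump s = (s - a%:R) * (1 - (s - a%:R)).
Proof. exact: (@humpE _ _ a%:Z). Qed.

Lemma hump_int (R : realType) (a : int) : hump (a%:~R : R) = 0.
Proof. by rewrite (@humpE _ _ a) ?lexx/=; [ring|rewrite lerDl]. Qed.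

Lemma hump_nat (R : realType) (a : nat) : hump (a%:R : R) = 0.
Proof. exact: (@hump_int _ a%:Z). Qed.

Lemma humpDint (R : realType) (s : R) (a : int) : hump (s + a%:~R) = hump s.
Proof.
have := fracpart_itv s; rewrite {1 2}/fracpart => /andP[h1 h2].
rewrite [RHS](@humpE _ _ (Num.floor s)); last lra.
by rewrite (@humpE _ _ (Num.floor s + a)) intrD; [ring|lra].
Qed.

Lemma humpDnat (R : realType) (s : R) (a : nat) : hump (s + a%:R) = hump s.
Proof. exact: (@humpDint _ _ a%:Z). Qed.

Lemma humpN (R : realType) (s : R) : hump (- s) = hump s.
Proof.
have := fracpart_itv s; rewrite {1 2}/fracpart => /andP[h1 h2].
rewrite [RHS](@humpE _ _ (Num.floor s)); last lra.
by rewrite (@humpE _ _ (- Num.floor s - 1)) intrD !intrN; [ring|lra].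
Qed.

Lemma hump_ge0 (R : realType) (s : R) : 0 <= hump s.
Proof. by have := fracpart_itv s; rewrite /hump; nra. Qed.

Lemma hump_le (R : realType) (s : R) : hump s <= 1 / 4.
Proof.
rewrite /hump; move: (fracpart s) => t.
have := sqr_ge0 (t - 1 / 2); rewrite expr2; lra.
Qed.

Lemma hump_lipschitz (R : realType) (s t : R) : `|hump s - hump t| <= `|s - t|.
Proof.
wlog st : s t / s <= t => [wl|].
  have [/wl//|/ltW/wl] := leP s t.
  by rewrite distrC [X in _ <= X]distrC.
rewrite (distrC s) (ger0_norm (_ : 0 <= t - s)) ?subr_ge0// ler_norml.
have := fracpart_itv s; rewrite {1 2}/fracpart => /andP[h1 h2].
have := hump_ge0 s; have := hump_le s; have := hump_ge0 t; have := hump_le t.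
have [st1|st1] := leP (s + 1) t; first lra.
have -> := @humpE _ s (Num.floor s); last lra.
have [ta|ta] := leP t ((Num.floor s)%:~R + 1).
  have -> := @humpE _ t (Num.floor s); last lra.
  by move: (Num.floor s)%:~R h1 h2 ta => a; nra.
have -> := @humpE _ t (Num.floor s + 1); last by rewrite intrD; lra.
by rewrite intrD; move: (Num.floor s)%:~R h1 h2 ta => a; nra.
Qed.

(** Partial sum of a Takagi-type series, with the parabola [hump] in place of the distance to the
    nearest integer. *)
Definition takagi_sum (R : realType) (n k : nat) (x : R) : R :=
  \sum_(j < k) n%:R ^- j * hump (n%:R ^+ j * x).

Definition takagi (R : realType) (n : nat) (x : R) : R :=
  limn (fun k => takagi_sum n k x).

Definition Pext (R : realType) (n : nat) (x : R) : R :=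
  hump x / (n%:R - 1) + takagi n x.

Lemma takagi_sumS (R : realType) n k (x : R) :
  takagi_sum n k.+1 x = takagi_sum n k x + n%:R ^- k * hump (n%:R ^+ k * x).
Proof. by rewrite /takagi_sum big_ord_recr. Qed.

Lemma natrX_gt0 (R : realType) n k : (1 < n)%N -> 0 < n%:R ^+ k :> R.
Proof. by move=> n1; rewrite exprn_gt0// ltr0n ltnW. Qed.

Lemma takagi_sum_nondecreasing (R : realType) n (x : R) : (1 < n)%N ->
  nondecreasing_seq (fun k => takagi_sum n k x).
Proof.
move=> n1; apply/nondecreasing_seqP => k.
by rewrite takagi_sumS lerDl mulr_ge0 ?hump_ge0// invr_ge0 ltW ?natrX_gt0.
Qed.

(** A new term is at most n^-k / 4, while n^-k drops by n^-k (1 - 1/n) >= n^-k / 2. This upper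
    envelope bounds the tail of the series by n^-k. *)
Lemma takagi_sum_upper_nonincreasing (R : realType) n (x : R) : (1 < n)%N ->
  nonincreasing_seq (fun k => takagi_sum n k x + n%:R ^- k).
Proof.
move=> n1; apply/nonincreasing_seqP => k.
have n2 : 2 <= n%:R :> R by rewrite ler_nat.
have nk : 0 < n%:R ^- k :> R by rewrite invr_gt0 natrX_gt0.
have := hump_le (n%:R ^+ k * x); rewrite takagi_sumS exprS invfM => b4.
have nV : n%:R^-1 <= 1 / 2 :> R by rewrite div1r lef_pV2 ?posrE; lra.
by nra.
Qed.

Lemma is_cvg_takagi_sum (R : realType) n (x : R) : (1 < n)%N ->
  cvgn (fun k => takagi_sum n k x).
Proof.
move=> n1; apply: nondecreasing_is_cvgn (takagi_sum_nondecreasing x n1) _.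
exists (takagi_sum n 0 x + n%:R ^- 0) => _ [k _ <-].
apply: le_trans (takagi_sum_upper_nonincreasing x n1 (leq0n k)).
by rewrite lerDl invr_ge0 ltW ?natrX_gt0.
Qed.

Lemma cvg_natrVX (R : realType) n : (1 < n)%N ->
  (fun k => n%:R ^- k : R) @ \oo --> 0.
Proof.
move=> n1; under eq_cvg do rewrite -exprVn.
apply: cvg_expr; rewrite ger0_norm ?invr_ge0// invf_lt1 ?ltr1n// ltr0n ltnW//.
Qed.

Lemma takagi_bounds (R : realType) n k (x : R) : (1 < n)%N ->
  takagi_sum n k x <= takagi n x <= takagi_sum n k x + n%:R ^- k.
Proof.
move=> n1; rewrite (nondecreasing_cvgn_le (takagi_sum_nondecreasing x n1)) /=.
  2: exact: is_cvg_takagi_sum.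
have cv : (fun k => takagi_sum n k x + n%:R ^- k) @ \oo --> takagi n x.
  rewrite -[X in _ --> X]addr0; apply: cvgD; first exact: is_cvg_takagi_sum.
  exact: cvg_natrVX.
rewrite -(cvg_lim _ cv)//.
apply: (nonincreasing_cvgn_ge (takagi_sum_upper_nonincreasing x n1)).
by apply/cvg_ex; exists (takagi n x).
Qed.

Lemma takagi_sum_periodic (R : realType) n k a (x : R) :
  takagi_sum n k (x + a%:R) = takagi_sum n k x.
Proof.
apply: eq_bigr => j _; congr (_ * _).
by rewrite mulrDr -natrX -natrM humpDnat.
Qed.

Lemma takagi_sumN (R : realType) n k (x : R) :
  takagi_sum n k (- x) = takagi_sum n k x.
Proof. by apply: eq_bigr => j _; rewrite mulrN humpN. Qed.

Lemma PextDnat (R : realType) n a (x : R) : Pext n (x + a%:R) = Pext n x.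
Proof.
rewrite /Pext /takagi humpDnat; congr (_ + lim _).
by under eq_fun do rewrite takagi_sum_periodic.
Qed.

Lemma PextN (R : realType) n (x : R) : Pext n (- x) = Pext n x.
Proof.
rewrite /Pext /takagi humpN; congr (_ + lim _).
by under eq_fun do rewrite takagi_sumN.
Qed.

Lemma Pext_nat (R : realType) n a : Pext n (a%:R : R) = 0.
Proof.
rewrite /Pext hump_nat mul0r add0r /takagi.
under eq_fun => k.
  rewrite /takagi_sum big1; last by move=> j _; rewrite -natrX -natrM hump_nat mulr0.
  over.
exact: lim_cst.
Qed.

Lemma Pext_onem (R : realType) n (x : R) : Pext n (1 - x) = Pext n x.
Proof. by rewrite addrC (PextDnat n 1) PextN. Qed.

(** * The piecewise linear function eta, the functional equation and the series *)

Definition eta_fun (R : realType) (n : nat) (t : R) : R :=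
  (n%:R ^+ 2 * hump t - hump (n%:R * t)) / (n%:R * (n%:R - 1)).

Lemma natrB1_gt0 (R : realType) n : (1 < n)%N -> 0 < n%:R - 1 :> R.
Proof. by move=> n1; rewrite subr_gt0 ltr1n. Qed.

(** On such an interval both humps are single parabolas, and their quadratic terms n^2 t^2 and
    (nt)^2 cancel. *)
Lemma eta_funE (R : realType) n (rho : nat) (t : R) : (1 < n)%N ->
  0 <= t <= 1 -> rho%:R <= n%:R * t <= rho%:R + 1 ->
  eta_fun n t = (rho%:R * (rho%:R + 1) + n%:R * t * (n%:R - 1 - 2 * rho%:R))
                / (n%:R * (n%:R - 1)).
Proof.
move=> n1 t01 tr; rewrite /eta_fun (humpE_nat tr).
rewrite (@humpE_nat _ t 0) ?add0r//; congr (_ / _); ring.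
Qed.

Lemma takagi_sum_recl (R : realType) n k (x : R) : (1 < n)%N ->
  takagi_sum n k.+1 x = hump x + takagi_sum n k (n%:R * x) / n%:R.
Proof.
move=> n1; rewrite /takagi_sum big_ord_recl expr0 invr1 !mul1r mulr_suml.
congr (_ + _); apply: eq_bigr => j _.
by rewrite lift0 {2}exprSr exprS invfM mulrA; ring.
Qed.

Lemma takagi_rec (R : realType) n (x : R) : (1 < n)%N ->
  takagi n x = hump x + takagi n (n%:R * x) / n%:R.
Proof.
move=> n1; rewrite {1}/takagi; apply: cvg_lim => //; rewrite -cvg_shiftS /=.
under eq_cvg do rewrite takagi_sum_recl//.
by apply: cvgD; [exact: cvg_cst|apply: cvgMl; exact: is_cvg_takagi_sum].
Qed.

Lemma Pext_rec (R : realType) n (x : R) : (1 < n)%N ->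
  Pext n x = Pext n (n%:R * x) / n%:R + eta_fun n x.
Proof.
move=> n1; rewrite /Pext {1}takagi_rec// /eta_fun.
have := natrB1_gt0 R n1; have : 0 < n%:R :> R by rewrite ltr0n ltnW.
by move=> h1 h2; field; rewrite !lt0r_neq0.
Qed.

(** Finite telescoping with its remainder, which is at most n^-k / (4(n - 1)) and so disappears in
    the limit. *)
Lemma sum_eta_fun (R : realType) n k (x : R) : (1 < n)%N ->
  \sum_(j < k) n%:R ^- j * eta_fun n (n%:R ^+ j * x)
  = hump x / (n%:R - 1) + takagi_sum n k x
    - n%:R ^- k * hump (n%:R ^+ k * x) / (n%:R - 1).
Proof.
move=> n1; have nB1 := natrB1_gt0 R n1.
have n0 : 0 < n%:R :> R by rewrite ltr0n ltnW.
elim: k => [|k IHk].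
  by rewrite /takagi_sum !big_ord0 expr0 invr1 !mul1r; ring.
rewrite big_ord_recr /= IHk takagi_sumS /eta_fun mulrA -exprS.
have nk : n%:R ^+ k != 0 :> R by rewrite expf_neq0// lt0r_neq0.
rewrite (exprS _ k); field.
by rewrite nk !lt0r_neq0.
Qed.

Lemma eta_fun_fracpart (R : realType) n (x : R) :
  eta_fun n (fracpart x) = eta_fun n x.
Proof.
rewrite /eta_fun /fracpart -intrN humpDint mulrDr -[n%:R]/(n%:~R) -intrM.
by rewrite humpDint.
Qed.

Lemma cvg_sum_eta_fun (R : realType) n (x : R) : (1 < n)%N ->
  series (fun j => n%:R ^- j * eta_fun n (fracpart (n%:R ^+ j * x))) @ \oo
    --> Pext n x.
Proof.
move=> n1; rewrite /series /=.
under eq_cvg => k.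
  under eq_bigr do rewrite eta_fun_fracpart.
  rewrite big_mkord sum_eta_fun//.
  over.
rewrite -(subr0 (Pext n x)); apply: cvgB.
  by apply: cvgD; [exact: cvg_cst|exact: is_cvg_takagi_sum].
rewrite -(mul0r (n%:R - 1)^-1); apply: cvgMl.
apply: (squeeze_cvgr (f := fun=> 0) (h := fun k => n%:R ^- k)); last exact: cvg_natrVX.
  2: exact: cvg_cst.
near=> k; have nk := @natrX_gt0 R n k n1.
rewrite mulr_ge0 ?hump_ge0 ?invr_ge0 ?(ltW nk)//= ler_piMr ?invr_ge0 ?(ltW nk)//.
by have := hump_le (n%:R ^+ k * x); lra.
Unshelve. all: by end_near. Qed.

(** In each of the first [k] terms the factor n^-j cancels the dilation n^j, so each is 1-Lipschitz;
    hump / (n - 1) adds one more such term and the tails differ by at most n^-k. Continuity follows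
    by fixing [k] first and then letting the points approach each other. *)
Lemma Pext_lipschitz_upto (R : realType) n k (x y : R) : (1 < n)%N ->
  `|Pext n x - Pext n y| <= k.+1%:R * `|x - y| + n%:R ^- k.
Proof.
move=> n1; have nk := @natrX_gt0 R n k n1.
have nB1 : 1 <= n%:R - 1 :> R by rewrite lerBrDr -[1 + 1]/(2%:R) ler_nat.
have sumL : `|takagi_sum n k x - takagi_sum n k y| <= k%:R * `|x - y|.
  rewrite /takagi_sum -sumrB; apply: le_trans (ler_norm_sum _ _ _) _.
  have -> : k%:R * `|x - y| = \sum_(j < k) `|x - y|.
    by rewrite sumr_const card_ord mulr_natl.
  apply: ler_sum => j _; have nj := @natrX_gt0 R n j n1.
  rewrite -mulrBr normrM gtr0_norm ?invr_gt0// mulrC ler_pdivrMr//.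
  apply: le_trans (hump_lipschitz _ _) _.
  by rewrite -mulrBr normrM gtr0_norm// mulrC.
have := takagi_bounds k x n1; have := takagi_bounds k y n1.
have := hump_lipschitz x y.
have -> : Pext n x - Pext n y
  = (hump x - hump y) / (n%:R - 1) + (takagi n x - takagi n y).
  by rewrite /Pext; ring.
move=> hL /andP[b1 b2] /andP[b3 b4].
have hq : `|(hump x - hump y) / (n%:R - 1)| <= `|x - y|.
  rewrite normrM normfV [X in _ / X]ger0_norm; last lra.
  by rewrite ler_pdivrMr; [rewrite (le_trans hL)// ler_peMr|lra].
apply: le_trans (ler_normD _ _) _; 
have -> : k.+1%:R * `|x - y| + n%:R ^- k = `|x - y| + (k%:R * `|x - y| + n%:R ^- k).
  by rewrite -natr1; ring.
apply: lerD => //; move: sumL; rewrite !ler_norml => /andP[c1 c2].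
lra.
Qed.

Lemma Pext_continuous (R : realType) n : (1 < n)%N ->
  continuous (Pext n : R -> R).
Proof.
move=> n1 x; apply/cvgrPdist_lt => e e0.
have [|k _ /(_ k (leqnn k)) /= nke] := cvgr_lt 0 (@cvg_natrVX R n n1) (e / 2).
  by rewrite divr_gt0.
near=> y; apply: le_lt_trans (Pext_lipschitz_upto k x y n1) _.
rewrite [e]splitr ler_ltD//.
rewrite -ler_pdivlMl ?ltr0n//.
near: y; apply: cvgr_dist_le; first exact: cvg_id.
by rewrite mulr_gt0 ?invr_gt0 ?ltr0n// divr_gt0.
Unshelve. all: by end_near. Qed.

Lemma eta_fun_continuous (R : realType) n : (1 < n)%N ->
  continuous (eta_fun n : R -> R).
Proof.
have hc : continuous (@hump R).
  move=> x; apply/cvgrPdist_le => e e0; near=> y.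
  apply: le_trans (hump_lipschitz _ _) _.
  by near: y; apply: cvgr_dist_le => //; exact: cvg_id.
move=> n1 x; apply: cvgMl; apply: cvgB; first by apply: cvgMr; exact: hc.
apply: (continuous_comp (f := fun y : R => n%:R * y)); last exact: hc.
by apply: cvgMr; exact: cvg_id.
Unshelve. all: by end_near. Qed.

Lemma is_eta_eta_fun (R : realType) n : (1 < n)%N ->
  is_eta n (eta_fun n : R -> R).
Proof.
move=> n1; have n0 : 0 < n%:R :> R by rewrite ltr0n ltnW.
have nB1 := natrB1_gt0 R n1.
have nn : 0 < n%:R * (n%:R - 1) :> R by rewrite mulr_gt0.
have subitv (rho : nat) (t : R) : (rho < n)%N ->
    t \in `[rho%:R / n%:R, rho.+1%:R / n%:R] ->
    0 <= t <= 1 /\ rho%:R <= n%:R * t <= rho%:R + 1.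
  move=> rn; rewrite in_itv /= ler_pdivrMr// ler_pdivlMr// -natr1.
  rewrite [t * _]mulrC => /andP[t1 t2].
  have : (0 : R) <= rho%:R by [].
  have : rho%:R + 1 <= n%:R :> R by rewrite natr1 ler_nat.
  by move=> h1 h2; split; [nra|lra].
split.
- exact/continuous_subspaceT/eta_fun_continuous.
- move=> t; rewrite in_itv/= => t01.
  (* The integer part of nt serves as [rho], except at t = 1, where it would be n instead of n -
     1. *)
  have [rho rn tr] : exists2 rho : nat, (rho < n)%N & rho%:R <= n%:R * t <= rho%:R + 1.
    have [->|t1] := eqVneq t 1.
      exists n.-1; first by rewrite prednK// ltnW.
      by rewrite mulr1 natr1 prednK ?(ltnW n1)// lexx ler_nat leq_pred.
    have nt0 : 0 <= n%:R * t by case/andP: t01 => t0 _; rewrite mulr_ge0// ltW.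
    exists (Num.truncn (n%:R * t)).
      rewrite truncn_lt_nat// -[X in _ < X]mulr1 ltr_pM2l// lt_neqAle t1.
      by case/andP: t01.
    rewrite natr1 (ltW (truncnS_gt _)) andbT truncn_le//.
  rewrite (eta_funE n1 t01 tr) divr_ge0 ?(ltW nn)//.
  have rn1 : rho%:R + 1 <= n%:R :> R by rewrite natr1 ler_nat.
  have r0 : (0 : R) <= rho%:R by [].
  (* The value is a convex combination, with weight nt - rho, of the nonnegative values at the two
     ends of the interval. *)
  have -> : rho%:R * (rho%:R + 1) + n%:R * t * (n%:R - 1 - 2 * rho%:R)
    = (1 - (n%:R * t - rho%:R)) * (rho%:R * (n%:R - rho%:R))
      + (n%:R * t - rho%:R) * ((rho%:R + 1) * (n%:R - rho%:R - 1)) by ring.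
  by case/andP: tr => s1 s2; rewrite addr_ge0// mulr_ge0 ?mulr_ge0//; lra.
- move=> rho rn; exists ((n%:R * (n%:R - 1 - 2 * rho%:R)) / (n%:R * (n%:R - 1))).
  exists (rho%:R * (rho%:R + 1) / (n%:R * (n%:R - 1))) => t /(subitv _ _ rn)[t01 tr].
  by rewrite (eta_funE n1 t01 tr); ring.
- move=> rho rn; rewrite (@eta_funE _ _ rho)//.
  + rewrite mulrCA divff ?mulr1 ?lt0r_neq0//; congr (_ / _); ring.
  + by rewrite divr_ge0//= ler_pdivrMr// mul1r ler_nat.
  + by rewrite mulrCA divff ?mulr1 ?lt0r_neq0// lexx lerDl ler01.
Qed.

(** * Agreement with the digit sum formula at n-adic points *)

Lemma Blevel_nat (R : realType) n m k : (1 < n)%N ->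
  Blevel n m (k%:R / n%:R ^+ m : R)
  = m%:R * (k%:R / n%:R ^+ m)
    - 2 / ((n%:R - 1) * n%:R ^+ m) * (cum_digit_sum n k)%:R.
Proof.
move=> n1; rewrite /Blevel [n%:R ^+ m * (_ / _)]mulrC divfK ?natrK//.
by rewrite lt0r_neq0// natrX_gt0.
Qed.

Lemma bin2_natr (R : realType) a : ('C(a, 2))%:R = a%:R * (a%:R - 1) / 2 :> R.
Proof.
have /(congr1 (fun k : nat => k%:R : R)) := double_bin2 a.
rewrite /= natrD !natrM => H.
apply: (mulfI (_ : 2 != 0 :> R)) => //; lra.
Qed.

(** Each of the [m] digit positions averages (n - 1)/2 over the n^m numbers. In particular B_m(1) =
    0. *)
Lemma cum_digit_sum_pow (R : realType) n m : (1 < n)%N ->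
  (cum_digit_sum n (n ^ m))%:R = m%:R * n%:R ^+ m * (n%:R - 1) / 2 :> R.
Proof.
move=> n1; elim: m => [|m IHm].
  by rewrite expn0 (@cum_digit_sum_small n 1 n1 (ltnW n1)) bin2_natr; ring.
rewrite expnS -[(n * n ^ m)%N]addn0 cum_digit_sum_digit//.
rewrite mul0n cum_digit_sum0 !addn0 natrD !natrM natrX IHm.
rewrite (cum_digit_sum_small n1 (leqnn n)) bin2_natr exprS -[m.+1]addn1 natrD; ring.
Qed.

(** Induction on [m] through the leading digit [a]: for x = (a + y)/n the periodicity of P gives
    P(x) = P(y)/n + eta(x), and [cum_digit_sum_digit] gives B the same recursion. *)
Lemma Pext_Blevel (R : realType) n m k : (1 < n)%N -> (k <= n ^ m)%N ->
  Pext n (k%:R / n%:R ^+ m : R) = Blevel n m (k%:R / n%:R ^+ m).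
Proof.
move=> n1; have n0 : (n%:R : R) != 0 by rewrite pnatr_eq0 -lt0n ltnW.
have nB : (n%:R - 1 : R) != 0 by rewrite lt0r_neq0// natrB1_gt0.
elim: m k => [|m IHm] k kn.
  rewrite Blevel_nat// expr0 divr1 Pext_nat cum_digit_sum_small//; last first.
    by rewrite (leq_trans kn)// expn0 ltnW.
  by move: kn; rewrite expn0; case: k => [|[]]// _; rewrite mul0r mulr0 subrr.
have Nm : (n%:R ^+ m : R) != 0 by rewrite expf_neq0.
have [a [r [an rm ->]]] : exists a r,
    [/\ (a < n)%N, (r <= n ^ m)%N & k = (a * n ^ m + r)%N].
  have N0 : (0 < n ^ m)%N by rewrite expn_gt0 ltnW.
  have [lt|ge] := ltnP k (n ^ m.+1).
    exists (k %/ n ^ m)%N, (k %% n ^ m)%N.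
    by rewrite ltn_divLR// -expnS lt ltnW ?ltn_mod// -divn_eq.
  (* The right endpoint x = 1 is read as leading digit n - 1 followed by a full remainder. *)
  exists n.-1, (n ^ m)%N; rewrite prednK ?(ltnW n1)// leqnn leqnn; split=> //.
  rewrite addnC -mulSn prednK ?(ltnW n1)// -expnS.
  by apply/eqP; rewrite eqn_leq kn ge.
have xE : (a * n ^ m + r)%:R / n%:R ^+ m.+1 = (a%:R + r%:R / n%:R ^+ m) / n%:R :> R.
  by rewrite natrD natrM natrX exprS; field; rewrite n0.
set x := _ / _ in xE *.
have nx : n%:R * x = r%:R / n%:R ^+ m + a%:R.   by rewrite xE; field; rewrite n0 Nm.
have y01 : 0 <= (r%:R / n%:R ^+ m : R) <= 1.
  have Nm0 := natrX_gt0 R m n1; apply/andP; split; first by rewrite divr_ge0// ltW.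
  by rewrite ler_pdivrMr// mul1r -natrX ler_nat.
have a1n : a%:R + 1 <= n%:R :> R by rewrite natr1 ler_nat.
have a0 : 0 <= a%:R :> R by [].
rewrite Pext_rec// nx PextDnat IHm// Blevel_nat//.
rewrite (@eta_funE _ _ a) ?nx//; last by lra.
  rewrite /x Blevel_nat// cum_digit_sum_digit// (cum_digit_sum_small n1 (ltnW an)).
  rewrite digit_sum_small// !natrD !natrM natrX bin2_natr cum_digit_sum_pow//.
  by rewrite exprS -[m.+1%:R]natr1; field; rewrite n0 Nm nB.
rewrite xE; move: y01; move: (r%:R / _) => y /andP[y0 y1].
have n00 : (0 : R) < n%:R by rewrite ltr0n ltnW.
apply/andP; split; first by rewrite divr_ge0// ?addr_ge0// ltW.
by rewrite ler_pdivrMr// mul1r; lra.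
Qed.

Lemma nadic_level_leq (R : realType) n m p : (0 < n)%N -> (m <= p)%N ->
  nadic_level R n m `<=` nadic_level R n p.
Proof.
move=> n0 mp x [k km ->]; exists (k * n ^ (p - m))%N.
  by rewrite -{2}(subnK mp) expnD [(n ^ (p - m) * _)%N]mulnC leq_mul2r km orbT.
have nn : (n%:R : R) != 0 by rewrite pnatr_eq0 -lt0n.
rewrite -{2}(subnK mp) exprD natrM natrX; field.
by rewrite !expf_neq0.
Qed.

Lemma Pext_nadic_level (R : realType) n m (x : R) : (1 < n)%N ->
  nadic_level R n m x -> Pext n x = Blevel n m x.
Proof. by move=> n1 [k km ->]; exact: Pext_Blevel. Qed.

Lemma cvg_Blevel (R : realType) n (x : R) : (1 < n)%N -> nadic R n x ->
  (fun m => Blevel n m x) @ \oo --> Pext n x.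
Proof.
move=> n1 [m _ xm]; apply: cvg_near_cst; exists m => // p /= mp.
by rewrite -(Pext_nadic_level n1 (nadic_level_leq (ltnW n1) mp xm)).
Qed.

Lemma Pnadic_Pext (R : realType) n (x : R) : (1 < n)%N -> nadic R n x ->
  Pnadic n x = Pext n x.
Proof. by move=> n1 xn; apply/cvg_lim => //; exact: cvg_Blevel. Qed.

(** * The mean inequality, first at n-adic points and then on the unit interval *)

Lemma mean_nadic (R : realType) n m (k : nat -> nat) (x : 'I_n -> R) :
  (1 < n)%N -> (forall i, (i < n)%N -> (k i <= n ^ m)%N) ->
  (forall i, x i = (k i)%:R / n%:R ^+ m) ->
  mean x = (\sum_(i < n) k i)%N%:R / n%:R ^+ m.+1
  /\ (\sum_(i < n) k i <= n ^ m.+1)%N.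
Proof.
move=> n1 kn xE; have n0 : (0 : R) < n%:R by rewrite ltr0n ltnW.
have Nm := natrX_gt0 R m n1; split.
  rewrite /mean; under eq_bigr do rewrite xE; rewrite -mulr_suml -natr_sum exprS.
  by field; rewrite !lt0r_neq0.
rewrite expnS -[X in (_ <= X * _)%N](card_ord n) -sum_nat_const leq_sum// => i _.
exact: kn.
Qed.

Lemma Pext_mean_level (R : realType) n m (k : nat -> nat) (x : 'I_n -> R) :
  (1 < n)%N -> (forall i, (i < n)%N -> (k i <= n ^ m)%N) ->
  (forall i, x i = (k i)%:R / n%:R ^+ m) ->
  Pext n (mean x) <= n%:R^-1 * (\sum_(i < n) Pext n (x i))
                     + n%:R^-1 * (\sum_(i < n) `|x i - mean x|).
Proof.
move=> n1 kn xE; have n0 : (0 : R) < n%:R by rewrite ltr0n ltnW.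
have nB := natrB1_gt0 R n1; have Nm := natrX_gt0 R m n1.
set K := (\sum_(i < n) k i)%N.
have [meanE Kn] := mean_nadic n1 kn xE; rewrite -/K in meanE Kn.
have PE : \sum_(i < n) Pext n (x i) = m%:R * K%:R / n%:R ^+ m
    - 2 / ((n%:R - 1) * n%:R ^+ m) * (\sum_(i < n) cum_digit_sum n (k i))%:R.
  rewrite !natr_sum mulr_sumr mulr_suml mulr_sumr -sumrB; apply: eq_bigr => i _.
  by rewrite xE Pext_Blevel ?kn// Blevel_nat// mulrA.
have key := cum_digit_sum_superadd n1 kn.
set c : R := K%:R / n%:R; pose D : R := \sum_(i < n) `|(k i)%:R - c|.
have DE : \sum_(i < n) `|x i - mean x| = D / n%:R ^+ m.
  rewrite mulr_suml; apply: eq_bigr => i _; rewrite meanE xE exprS.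
  rewrite -[X in _ = _ / X](gtr0_norm Nm) -normf_div; congr `|_|.
  by rewrite /c; field; rewrite !lt0r_neq0.
(* From min(u, v) = (u + v)/2 - |u - v|/2 and the triangle inequality through the mean [c]. The
   diagonal contributes no distance, whence the factor n - 1 in place of n. *)
have minD : n%:R * K%:R - (n%:R - 1) * D
    <= (\sum_(i < n) \sum_(j < n) minn (k i) (k j))%:R :> R.
  have half (f : 'I_n -> R) : \sum_(i < n) \sum_(j < n) ((f i + f j) / 2)
      = n%:R * \sum_(i < n) f i.
    have inner i : \sum_(j < n) ((f i + f j) / 2)
        = (n%:R * f i + \sum_(j < n) f j) / 2.
      by rewrite -mulr_suml big_split /= sumr_const card_ord mulr_natl.
    rewrite (eq_bigr _ (fun i _ => inner i)) -mulr_suml big_split /= -mulr_sumr.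
    by rewrite sumr_const card_ord -mulr_natl; field.
  have dist : \sum_(i < n) \sum_(j < n) `|(k i)%:R - (k j)%:R| / 2
      <= (n%:R - 1) * D :> R.
    have -> : (n%:R - 1) * D = \sum_(i < n) \sum_(j < n | j != i)
        ((`|(k i)%:R - c| + `|(k j)%:R - c|) / 2).
      rewrite mulrBl mul1r -half -sumrB; apply: eq_bigr => i _.
      by rewrite (bigD1 i)//=; field.
    apply: ler_sum => i _; rewrite (bigD1 i)//= subrr normr0 mul0r add0r.
    apply: ler_sum => j _; rewrite ler_pM2r ?invr_gt0// (distrC (k j)%:R).
    by rewrite -[X in `|X|](subrKA c) ler_normD.
  have -> : (\sum_(i < n) \sum_(j < n) minn (k i) (k j))%:R
      = \sum_(i < n) \sum_(j < n) (minn (k i) (k j))%:R :> R.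
    by rewrite natr_sum; apply: eq_bigr => i _; rewrite natr_sum.
  rewrite {1}/K natr_sum -half lerBlDl -lerBlDr; apply: le_trans _ dist.
  rewrite -!sumrB; apply: ler_sum => i _; rewrite -!sumrB; apply: ler_sum => j _.
  have [h|/ltnW h] := leqP (k i) (k j).
    by rewrite distrC ger0_norm ?subr_ge0 ?ler_nat//; lra.
  by rewrite ger0_norm ?subr_ge0 ?ler_nat//; lra.
rewrite DE meanE Pext_Blevel// Blevel_nat// PE.
have {}key : 2 * (\sum_(i < n) cum_digit_sum n (k i))%:R
    + (n%:R * K%:R - (n%:R - 1) * D) <= 2 * (cum_digit_sum n K)%:R + K%:R :> R.
  apply: le_trans (lerD (lexx _) minD) _.
  by rewrite -!natrM -!natrD ler_nat.
move: key; move: (\sum_(i < n) _)%:R (cum_digit_sum n K)%:R (K%:R) => g G k'.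
rewrite -subr_ge0 => key; rewrite -subr_ge0.
(* The difference of the two sides is the slack in [key] divided by (n - 1)n^(m + 1). *)
have -> : n%:R^-1 * (m%:R * k' / n%:R ^+ m - 2 / ((n%:R - 1) * n%:R ^+ m) * g) +
  n%:R^-1 * (D / n%:R ^+ m) -
  (m.+1%:R * (k' / n%:R ^+ m.+1) - 2 / ((n%:R - 1) * n%:R ^+ m.+1) * G)
  = (2 * G + k' - (2 * g + (n%:R * k' - (n%:R - 1) * D)))
    / ((n%:R - 1) * n%:R ^+ m.+1).
  by rewrite exprS -[m.+1%:R]natr1; field; rewrite !lt0r_neq0.
by rewrite divr_ge0// mulr_ge0 ?ltW// natrX_gt0.
Qed.

Lemma Pnadic_mean_ineq (R : realType) n : (1 < n)%N ->
  mean_ineq n (nadic R n) (Pnadic n).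
Proof.
move=> n1 x xn; have /choice[m mP] : forall i, exists m, nadic_level R n m (x i).
  by move=> i; have [m _ xm] := xn i; exists m.
(* All points are brought to one common level, and their numerators are then extended by 0 to all
   natural indices. *)
pose M := \max_(i < n) m i.
have /choice[k kP] : forall i,
    exists k, (k <= n ^ M)%N /\ x i = k%:R / n%:R ^+ M.
  move=> i; have [k kn xk] : nadic_level R n M (x i).
    by apply: nadic_level_leq (mP i); [exact: ltnW|exact: leq_bigmax].
  by exists k.
pose k' j := oapp k 0%N (insub j).
have k'E (i : 'I_n) : k' i = k i by rewrite /k' valK.
have k'n j : (j < n)%N -> (k' j <= n ^ M)%N.
  by move=> jn; rewrite -[j]/(val (Ordinal jn)) k'E; have [] := kP (Ordinal jn).
have xE i : x i = (k' i)%:R / n%:R ^+ M by rewrite k'E; have [] := kP i.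
have [meanE Kn] := mean_nadic n1 k'n xE.
rewrite Pnadic_Pext//; last by exists M.+1 => //; exists (\sum_(i < n) k' i)%N.
under eq_bigr do rewrite Pnadic_Pext//.
exact: (Pext_mean_level n1 k'n xE).
Qed.

Lemma cvg_nadic_floor (R : realType) n (x : R) : (1 < n)%N -> 0 <= x ->
  (fun m => (Num.truncn (n%:R ^+ m * x))%:R / n%:R ^+ m : R) @ \oo --> x.
Proof.
move=> n1 x0; apply/cvgrPdist_le => e e0.
near=> m.
have me : n%:R ^- m <= e by near: m; exact: (cvgr_le 0 (@cvg_natrVX R n n1)).
have nm := natrX_gt0 R m n1.
have nx0 : 0 <= n%:R ^+ m * x by rewrite mulr_ge0 ?(ltW nm).
have -> : x - (Num.truncn (n%:R ^+ m * x))%:R / n%:R ^+ m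
  = (n%:R ^+ m * x - (Num.truncn (n%:R ^+ m * x))%:R) / n%:R ^+ m.
  by field; rewrite lt0r_neq0.
apply: le_trans me; rewrite normrM [X in _ * X]gtr0_norm ?invr_gt0//.
rewrite ler_piMl ?invr_ge0 ?(ltW nm)//.
have := truncn_le (n%:R ^+ m * x); rewrite nx0 => t1.
have := truncnS_gt (n%:R ^+ m * x); rewrite -natr1 => t2.
by rewrite ger0_norm; lra.
Unshelve. all: by end_near. Qed.

(** Each point is approximated from below by its level-m n-adic floor; both sides of the inequality
    converge because P is continuous. *)
Lemma Pext_mean_ineq (R : realType) n : (1 < n)%N ->
  mean_ineq n `[0, 1] (Pext n : R -> R).
Proof.
move=> n1 x x01.
pose k m j :=
  oapp (fun i : 'I_n => Num.truncn (n%:R ^+ m * x i)) 0%N (insub j).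
pose y m (i : 'I_n) : R := (k m i)%:R / n%:R ^+ m.
have kE m (i : 'I_n) : k m i = Num.truncn (n%:R ^+ m * x i) by rewrite /k valK.
have kn m j : (j < n)%N -> (k m j <= n ^ m)%N.
  move=> jn; rewrite -[j]/(val (Ordinal jn)) kE.
  have := x01 (Ordinal jn); rewrite /= in_itv/= => /andP[x0 x1].
  have nm := natrX_gt0 R m n1.
  rewrite -(ler_nat R) natrX (@le_trans _ _ (n%:R ^+ m * x (Ordinal jn)))//.
    by rewrite truncn_le mulr_ge0// ltW.
  by rewrite ger_pMr.
have yx i : y ^~ i @ \oo --> x i.
  rewrite /y; under eq_cvg do rewrite kE.
  by apply: cvg_nadic_floor => //; have := x01 i; rewrite /= in_itv/= => /andP[].
have meancvg : (fun m => mean (y m)) @ \oo --> mean x.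
  by apply: cvgMr; apply: (cvg_big add_continuous) => i _; exact: yx.
have Pcvg (u : nat -> R) (l : R) : u @ \oo --> l ->
    (fun m => Pext n (u m)) @ \oo --> Pext n l.
  by move=> ul; apply: continuous_cvg => //; exact: Pext_continuous.
apply: (@ler_cvg_to _ \oo _ _ (fun m => Pext n (mean (y m)))
  (fun m => n%:R^-1 * (\sum_(i < n) Pext n (y m i))
            + n%:R^-1 * (\sum_(i < n) `|y m i - mean (y m)|))).
- exact: Pcvg.
- apply: cvgD; apply: cvgMr; apply: (cvg_big add_continuous) => i _; first exact: Pcvg.
  by apply: cvg_norm; apply: cvgB => //; exact: yx.
- by apply: nearW => m; apply: (Pext_mean_level n1 (kn m)).
Qed.

(** * Size of P: global bounds, membership in the class and logarithmic growth *)

Lemma Pext_ge_hump (R : realType) n (x : R) : (1 < n)%N -> hump x <= Pext n x.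
Proof.
move=> n1; have /andP[+ _] := takagi_bounds 1 x n1.
rewrite /takagi_sum big_ord1 expr0 invr1 !mul1r /Pext => h.
have : 0 <= hump x / (n%:R - 1) by rewrite divr_ge0 ?hump_ge0 ?ltW ?natrB1_gt0.
lra.
Qed.

Lemma Pext_ge0 (R : realType) n (x : R) : (1 < n)%N -> 0 <= Pext n x.
Proof. by move=> n1; rewrite (le_trans (hump_ge0 x)) ?Pext_ge_hump. Qed.

Lemma Pext_le2 (R : realType) n (x : R) : (1 < n)%N -> Pext n x <= 2.
Proof.
move=> n1; have /andP[_ +] := takagi_bounds 0 x n1.
rewrite /takagi_sum big_ord0 expr0 invr1 add0r /Pext => h.
have nB1 : 1 <= n%:R - 1 :> R by rewrite lerBrDr -[1 + 1]/(2%:R) ler_nat.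
suff : hump x / (n%:R - 1) <= 1 by lra.
by rewrite ler_pdivrMr; [have := hump_le x; lra|lra].
Qed.

Lemma Pext_classB11 (R : realType) n : (1 < n)%N -> classB11 n (Pext n : R -> R).
Proof.
move=> n1; split.
- exact/continuous_subspaceT/Pext_continuous.
- by move=> x _; exact: Pext_ge0.
- exact: (Pext_nat R n 0).
- exact: (Pext_nat R n 1).
- exact: Pext_mean_ineq.
Qed.

Lemma Pext_rec_small (R : realType) n (x : R) : (1 < n)%N -> 0 <= x ->
  n%:R * x <= 1 -> Pext n x = Pext n (n%:R * x) / n%:R + x.
Proof.
move=> n1 x0 nx; have n1R : 1 < n%:R :> R by rewrite ltr1n.
have n0 : (0 : R) < n%:R by lra.
rewrite Pext_rec//; congr (_ + _); rewrite (@eta_funE _ _ 0)//.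
- by field; rewrite !lt0r_neq0 ?subr_gt0.
- by apply/andP; split=> //; nra.
- by rewrite add0r nx mulr_ge0// ltW.
Qed.

(** Compactness range 1/(2n) <= x <= 1/2 first, then scaling by n: P(x) = P(nx)/n + x, while L(x) =
    x ln(1/x) satisfies L(x) = L(nx)/n + x ln n. The bounds propagate because c ln n <= 1 <= C ln
    n. *)
Lemma Pext_log_bounds (R : realType) n : (1 < n)%N ->
  exists c C : R, [/\ 0 < c, c <= C & forall x, 0 < x <= 1 / 2 ->
    c * (x * ln (1 / x)) <= Pext n x <= C * (x * ln (1 / x))].
Proof.
move=> n1; have n1R : 2 <= n%:R :> R by rewrite ler_nat.
have n0 : (0 : R) < n%:R by lra.
pose l2 : R := ln 2; pose ln_ : R := ln n%:R.
have l20 : 0 < l2 by rewrite ln_gt0 ?ltr1n.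
have l2n : l2 <= ln_ by rewrite ler_ln ?posrE.
have l2nE : ln (2 * n%:R) = l2 + ln_ by rewrite lnM ?posrE.
(* On the base range the lower constant comes from P(x) >= x(1 - x) >= x/2 and ln(1/x) <= ln(2n),
   the upper one from P <= 2 and x ln(1/x) >= ln 2 / (2n). *)
exists (2 * (l2 + ln_))^-1, (4 * n%:R / l2); split.
- by rewrite invr_gt0; lra.
- rewrite ler_pdivlMr// -ler_pdivlMl ?invr_gt0; last lra.
  rewrite invrK; nra.
pose H (x : R) := (2 * (l2 + ln_))^-1 * (x * ln (1 / x)) <= Pext n x
                  <= 4 * n%:R / l2 * (x * ln (1 / x)).
have base x : 1 / (2 * n%:R) <= x -> x <= 1 / 2 -> H x.
  move=> xl xu; have x0 : 0 < x by apply: lt_le_trans xl; rewrite divr_gt0//; lra.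
  have lnx : ln (1 / x) = - ln x by rewrite div1r lnV ?posrE.
  have lnl : l2 <= - ln x.
    by rewrite -lnx ler_ln ?posrE ?divr_gt0// ler_pdivlMr//; lra.
  have lnu : - ln x <= l2 + ln_.
    rewrite -lnx -l2nE ler_ln ?posrE ?divr_gt0 ?mulr_gt0// ler_pdivrMr//.
    by move: xl; rewrite ler_pdivrMr ?mulr_gt0//; lra.
  rewrite /H lnx; apply/andP; split.
    apply: le_trans (Pext_ge_hump x n1).
    rewrite (@humpE_nat _ x 0) ?subr0; last by apply/andP; split; lra.
    rewrite ler_pdivrMl; last lra.
    have h1 : x * - ln x <= x * (l2 + ln_) by rewrite ler_wpM2l// ltW.
    have h2 : 0 <= x * (l2 + ln_) * (1 - 2 * x) by rewrite !mulr_ge0//; lra.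
    lra.
  apply: le_trans (Pext_le2 x n1) _.
  rewrite mulrAC ler_pdivlMr//; move: xl; rewrite ler_pdivrMr ?mulr_gt0// => xl.
  have h : (2 * n%:R * x) * l2 <= (2 * n%:R * x) * - ln x.
    by rewrite ler_wpM2l// mulr_ge0 ?(ltW x0)//.
  have h3 : 1 * l2 <= (2 * n%:R * x) * l2 by rewrite ler_wpM2r ?(ltW l20)//; lra.
  lra.
(* Here [m] bounds the number of multiplications by n that bring x into the base range. A point
   below that range has nx <= 1/2, so the hypothesis applies to nx. *)
have Hind m x : 1 / (2 * n%:R) <= n%:R ^+ m * x -> 0 < x <= 1 / 2 -> H x.
  elim: m x => [|m IHm] x.
    by rewrite expr0 [1 * x]mul1r => xl /andP[_ xu]; exact: base.
  rewrite exprSr -mulrA => xl /andP[x0 xu].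
  have [xn|xn] := leP (1 / (2 * n%:R)) x; first exact: base.
  have nx : n%:R * x <= 1 / 2.
    by move: xn; rewrite ltr_pdivlMr ?mulr_gt0//; lra.
  have nx0 : 0 < n%:R * x by rewrite mulr_gt0.
  have {IHm} := IHm _ xl; rewrite nx nx0 => /(_ isT).
  rewrite /H (Pext_rec_small n1 (ltW x0)); last lra.
  rewrite !div1r !lnV ?posrE// lnM ?posrE// -/ln_.
  move: (Pext n _) (ln x) => p L /andP[h1 h2].
  have xl2 : x * l2 <= x * ln_ by rewrite ler_wpM2l// ltW.
  have D0 : 0 < 2 * (l2 + ln_) by lra.
  have {}h1 : n%:R * (x * - (ln_ + L)) <= p * (2 * (l2 + ln_)).
    by move: h1; rewrite ler_pdivrMl// mulrA [_ * p]mulrC.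
  have {}h2 : p * l2 <= 4 * n%:R * (n%:R * (x * - (ln_ + L))).
    by move: h2; rewrite mulrAC ler_pdivlMr// -(mulrA n%:R x).
  apply/andP; split.
    have pn : x * - (ln_ + L) <= 2 * (l2 + ln_) * (p / n%:R).
      by rewrite mulrA ler_pdivlMr// [leLHS]mulrC [leRHS]mulrC.
    rewrite ler_pdivrMl//; have : 0 <= x * l2 by rewrite mulr_ge0// ltW.
    lra.
  have pn : p / n%:R * l2 <= 4 * n%:R * (x * - (ln_ + L)).
    by rewrite mulrAC ler_pdivrMr// -(mulrA (4 * n%:R)) [x * _ * n%:R]mulrC.
  rewrite mulrAC ler_pdivlMr// mulrDl.
  have : x * l2 <= n%:R * (x * ln_).
    apply: le_trans xl2 _; rewrite ler_peMl//; last lra.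
    by rewrite mulr_ge0//; lra.
  have : 0 <= n%:R * (x * ln_) by rewrite mulr_ge0 ?mulr_ge0//; lra.
  lra.
move=> x x0u; have /andP[x0 xu] := x0u.
(* With m the integer part of 1/x plus 1, n^m > m > 1/x, so n^m x exceeds 1. *)
have := @Hind (Num.truncn x^-1).+1 x; apply => //.
rewrite ler_pdivrMr ?mulr_gt0//.
have h1 : x^-1 < n%:R ^+ (Num.truncn x^-1).+1.
  apply: lt_le_trans (truncnS_gt _) _; rewrite -natrX ler_nat ltnW//.
  exact: ltn_expl.
have h2 : 1 < n%:R ^+ (Num.truncn x^-1).+1 * x.
  by rewrite -ltr_pdivrMr// div1r.
nra.
Qed.

(** * The n-adic martingale of an indicator *)

Definition cell (R : realType) (n m k : nat) : set R :=
  `[k%:R / n%:R ^+ m, k.+1%:R / n%:R ^+ m[%classic.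
Arguments cell : clear implicits.

Definition cell_index (R : realType) (n m : nat) (x : R) : nat :=
  Num.truncn (n%:R ^+ m * x).

Lemma cellP (R : realType) n m k (x : R) : (1 < n)%N ->
  cell R n m k x <-> 0 <= x /\ cell_index n m x = k.
Proof.
move=> n1; have nm := natrX_gt0 R m n1.
rewrite /cell /= in_itv/= ler_pdivrMr// ltr_pdivlMr// [x * _]mulrC /cell_index.
split=> [/andP[h1 h2]|[x0 <-]].
  split; last by apply/eqP; rewrite truncn_eq ?h1//; apply: le_trans h1.
  by rewrite -(pmulr_rge0 _ nm); apply: le_trans h1.
by rewrite truncn_le truncnS_gt mulr_ge0// ltW.
Qed.

Lemma cell_index_lt (R : realType) n m (x : R) : (1 < n)%N -> x < 1 ->
  (cell_index n m x < n ^ m)%N.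
Proof.
move=> n1 x1; have nm := natrX_gt0 R m n1; have N0 : (0 < n ^ m)%N.
  by rewrite expn_gt0 ltnW.
rewrite -[X in (_ < X)%N](prednK N0) ltnS truncn_le_nat prednK// natrX.
by rewrite gtr_pMr.
Qed.

Lemma cell_index_divn (R : realType) n m (x : R) : (1 < n)%N -> 0 <= x ->
  cell_index n m x = (cell_index n m.+1 x %/ n)%N.
Proof.
move=> n1 x0; have n0 : (0 < n)%N by exact: ltnW.
have n0R : (0 : R) < n%:R by rewrite ltr0n.
set q := (_ %/ n)%N; have [] // : 0 <= x /\ cell_index n m x = q.
apply/(cellP _ _ _ n1); have nm := natrX_gt0 R m n1.
have : cell R n m.+1 (cell_index n m.+1 x) x by apply/cellP.
set p := cell_index n m.+1 x in q *.
rewrite /cell /= !in_itv/= exprS invfM => /andP[h1 h2]; apply/andP; split.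
  apply: le_trans h1; rewrite mulrA ler_pM2r ?invr_gt0// ler_pdivlMr//.
  by rewrite -natrM ler_nat leq_divM.
apply: lt_le_trans h2 _; rewrite mulrA ler_pM2r ?invr_gt0// ler_pdivrMr//.
by rewrite -natrM ler_nat ltn_ceil.
Qed.

Lemma trivIset_cell (R : realType) n m : (1 < n)%N ->
  trivIset setT (cell R n m).
Proof.
move=> n1; apply/trivIsetP => i j _ _ ij; apply/seteqP; split => // x [].
move=> /(cellP _ _ _ n1)[_ xi] /(cellP _ _ _ n1)[_ xj].
by move/eqP: ij; rewrite -xi -xj.
Qed.

Lemma measurable_cell (R : realType) n m k :
  measurable (cell R n m k : set (lebesgueType R)).
Proof. by apply: sub_caratheodory; exact: measurable_itv. Qed.

Lemma measurable_itv01 (R : realType) :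
  measurable (`[0, 1[%classic : set (lebesgueType R)).
Proof. by apply: sub_caratheodory; exact: measurable_itv. Qed.

Lemma leb_cell (R : realType) n m k : (1 < n)%N ->
  leb (cell R n m k) = (n%:R ^- m)%:E.
Proof.
move=> n1; have nm := natrX_gt0 R m n1.
rewrite [LHS](_ : _ = lebesgue_measure (cell R n m k))//.
rewrite /cell lebesgue_measure_itv/= lte_fin ltr_pM2r ?invr_gt0// ltr_nat ltnSn.
by rewrite -EFinB -mulrBl -natr1; congr (_%:E); ring.
Qed.

Lemma cell_sub01 (R : realType) n m k : (1 < n)%N -> (k < n ^ m)%N ->
  cell R n m k `<=` `[0, 1[.
Proof.
move=> n1 kn x; have nm := natrX_gt0 R m n1; rewrite /cell /= !in_itv/= => /andP[h1 h2].
rewrite (le_trans _ h1) ?divr_ge0 ?(ltW nm)//= (lt_le_trans h2)//.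
by rewrite ler_pdivrMr// mul1r -natrX ler_nat.
Qed.

(** Concrete form of the sigma-algebra of level [m]: membership depends on the cell alone. *)
Definition saturated (R : realType) n m (B : set R) : Prop :=
  (B `<=` `[0, 1[) /\
  forall x y, B x -> 0 <= y < 1 -> cell_index n m x = cell_index n m y -> B y.

Lemma cell_saturated (R : realType) n m k : (1 < n)%N -> (k < n ^ m)%N ->
  saturated n m (cell R n m k).
Proof.
move=> n1 kn; split; first exact: cell_sub01.
move=> x y /(cellP _ _ _ n1)[_ xk] /andP[y0 _] xy.
by apply/cellP => //; rewrite -xy.
Qed.

Lemma saturated_bigcup (R : realType) n m (B : set R) : (1 < n)%N ->
  saturated n m B ->
  B = \bigcup_k (if `[< (k < n ^ m)%N /\ cell R n m k `<=` B >]
                 then cell R n m k else set0).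
Proof.
move=> n1 [B01 Bsat]; apply/seteqP; split => x.
  move=> Bx; have := B01 _ Bx; rewrite /= in_itv /= => /andP[x0 x1].
  exists (cell_index n m x) => //; case: asboolP => [_|[]]; first exact/cellP.
  split; first exact: cell_index_lt.
  move=> y yk; apply: (Bsat x) => //.
    by have := cell_sub01 n1 (cell_index_lt m n1 x1) yk; rewrite /= in_itv.
  by move: yk => /(cellP _ _ _ n1)[].
by case=> k _; case: asboolP => // -[_]; exact.
Qed.

(** Saturated sets form a sigma-algebra on [0, 1) containing the cells; conversely
    [saturated_bigcup] writes each of them as a countable union of cells and empty sets. *)
Lemma nadic_sigmaE (R : realType) n m : (1 < n)%N ->
  nadic_sigma R n m = saturated n m.
Proof.
move=> n1; apply/seteqP; split => [|B Bsat].
  apply: smallest_sub => /=; last by move=> _ [k kn ->]; exact: cell_saturated.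
  split; first by split.
  - move=> B [B01 Bsat]; split; first by move=> x [].
    move=> x y [x01 Bx] y01 xy; split=> [|By]; first by rewrite /= in_itv.
    by apply: Bx; apply: Bsat By _ _; rewrite // /= in_itv.
  - move=> F Fsat; split; first by move=> x [i _ Fx]; have [+ _] := Fsat i; apply.
    move=> x y [i _ Fx] y01 xy; exists i => //.
    by have [_] := Fsat i; apply; [exact: Fx| |].
rewrite (saturated_bigcup n1 Bsat); apply: sigma_algebra_bigcup => k.
case: asboolP => [[kn _]|_]; last exact: sigma_algebra0.
by apply: sub_sigma_algebra; exists k.
Qed.

Lemma saturated_measurable (R : realType) n m (B : set R) : (1 < n)%N ->
  saturated n m B -> measurable (B : set (lebesgueType R)).
Proof.
move=> n1 /(saturated_bigcup n1)->; apply: bigcupT_measurable => k.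
by case: asboolP => _; [exact: measurable_cell|exact: measurable0].
Qed.

Lemma saturated_preimage (R : realType) n m (T : Type) (c : nat -> T)
    (f : R -> T) (Y : set T) :
  (forall x, 0 <= x < 1 -> f x = c (cell_index n m x)) ->
  saturated n m (`[0, 1[ `&` f @^-1` Y).
Proof.
move=> fc; split; first by move=> x [].
move=> x y [/=]; rewrite in_itv => x01 Yx y01 xy.
by rewrite fc// -xy -fc//; rewrite in_itv.
Qed.

Lemma measurable_step (R : realType) n m d (T : measurableType d)
    (c : nat -> T) (f : R -> T) : (1 < n)%N ->
  (forall x, 0 <= x < 1 -> f x = c (cell_index n m x)) ->
  @measurable_fun _ _ (lebesgueType R) T (`[0, 1[%classic : set R) f.
Proof.
move=> n1 fc _ Y mY; apply: (@saturated_measurable _ n m) => //.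
exact: saturated_preimage fc.
Qed.

Lemma bigcup_cell (R : realType) n m : (1 < n)%N ->
  `[0, 1[%classic = \big[setU/set0]_(k < n ^ m) cell R n m k.
Proof.
move=> n1; rewrite -bigcup_mkord; apply/seteqP; split => x.
  rewrite /= in_itv/= => /andP[x0 x1]; exists (cell_index n m x).
    exact: cell_index_lt.
  exact/cellP.
by case=> k /= kn; exact: cell_sub01.
Qed.

Lemma cell_split (R : realType) n m k : (1 < n)%N ->
  cell R n m k = \big[setU/set0]_(i < n) cell R n m.+1 (k * n + i).
Proof.
move=> n1; have n0 : (0 < n)%N by exact: ltnW.
rewrite -(bigcup_mkord n (fun i => cell R n m.+1 (k * n + i))).
apply/seteqP; split => x.
  move=> /(cellP _ _ _ n1)[x0]; rewrite cell_index_divn// => xk.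
  exists (cell_index n m.+1 x %% n)%N; first by rewrite /= ltn_mod.
  by apply/cellP => //; rewrite -xk -divn_eq.
case=> i /= ni /(cellP _ _ _ n1)[x0 xi]; apply/cellP => //; split=> //.
by rewrite cell_index_divn// xi divnMDl// divn_small// addn0.
Qed.

Lemma setI_cells (R : realType) n m (B : set R) : (1 < n)%N ->
  B `<=` `[0, 1[ -> B = \big[setU/set0]_(k < n ^ m) (B `&` cell R n m k).
Proof.
move=> n1 B01; rewrite -(bigcup_mkord _ (fun k => B `&` cell R n m k)).
rewrite -setI_bigcupr bigcup_mkord -bigcup_cell//.
by apply/esym/setIidPl.
Qed.

Lemma leb_sum_cells (R : realType) n m (B : set R) : (1 < n)%N ->
  measurable (B : set (lebesgueType R)) -> B `<=` `[0, 1[ ->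
  leb B = (\sum_(k < n ^ m) leb (B `&` cell R n m k))%E.
Proof.
move=> n1 mB B01; rewrite {1}(setI_cells m n1 B01).
have mF k : measurable (B `&` cell R n m k : set (lebesgueType R)).
  by apply: measurableI => //; exact: measurable_cell.
have tF : trivIset setT (fun k => B `&` cell R n m k).
  exact/trivIset_setIl/trivIset_cell.
exact: (measure_bigsetU (@leb R) mF tF).
Qed.

Lemma leb_cell_split (R : realType) n m k (B : set R) : (1 < n)%N ->
  measurable (B : set (lebesgueType R)) ->
  leb (B `&` cell R n m k)
  = (\sum_(i < n) leb (B `&` cell R n m.+1 (k * n + i)))%E.
Proof.
move=> n1 mB; rewrite (cell_split _ m k n1).
rewrite -(bigcup_mkord _ (fun i => cell R n m.+1 (k * n + i))) setI_bigcupr.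
rewrite (bigcup_mkord _ (fun i => B `&` cell R n m.+1 (k * n + i))).
have mF i : measurable (B `&` cell R n m.+1 (k * n + i) : set (lebesgueType R)).
  by apply: measurableI => //; exact: measurable_cell.
have tF : trivIset setT (fun i => B `&` cell R n m.+1 (k * n + i)).
  apply: trivIset_setIl; apply/trivIsetP => i j _ _ ij.
  have /trivIsetP := @trivIset_cell R n m.+1 n1.
  by apply => //; apply: contra ij; rewrite eqn_add2l.
exact: (measure_bigsetU (@leb R) mF tF).
Qed.

Lemma leb_fin_num (R : realType) (B : set R) :
  measurable (B : set (lebesgueType R)) -> B `<=` `[0, 1[ ->
  leb B \is a fin_num.
Proof.
move=> mB B01; rewrite ge0_fin_numE ?measure_ge0//.
(* The single cell of level 0 is [0, 1), whatever the base. *)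
apply: (@le_lt_trans _ _ (leb (cell R 2 0 0))).
  apply: (le_measure (@leb R)); rewrite ?inE//; first exact: measurable_cell.
  by apply: subset_trans B01 _; rewrite /cell expr0 !divr1.
by rewrite leb_cell// ltry.
Qed.

Lemma integral_step (R : realType) n m (c : nat -> R) (f : R -> R) (B : set R) :
  (1 < n)%N -> (forall k, 0 <= c k) ->
  (forall x, 0 <= x < 1 -> f x = c (cell_index n m x)) ->
  measurable (B : set (lebesgueType R)) -> B `<=` `[0, 1[ ->
  (\int[@leb R]_(x in B) (f x)%:E
   = \sum_(k < n ^ m) (c k)%:E * leb (B `&` cell R n m k))%E.
Proof.
move=> n1 c0 fc mB B01.
have mBk k : measurable (B `&` cell R n m k : set (lebesgueType R)).
  by apply: measurableI => //; exact: measurable_cell.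
rewrite {1}(setI_cells m n1 B01) ge0_integral_bigsetU//=.
- apply: eq_bigr => k _; rewrite -integral_cst//.
  apply: eq_integral => x; rewrite inE => -[Bx /(cellP _ _ _ n1)[_ xk]].
  by rewrite fc ?xk//; have := B01 _ Bx; rewrite /= in_itv.
- exact: index_enum_uniq.
- apply: trivIset_setIl; apply/trivIsetP => i j _ _ ij.
  have /trivIsetP := @trivIset_cell R n m n1.
  by apply => //; apply: contra ij => /eqP/val_inj->.
- rewrite -setI_cells//; apply/measurable_EFinP.
  apply: (@measurable_funS _ _ (lebesgueType R) _ (`[0, 1[%classic : set R) B f) => //.
    exact: measurable_itv01.
  exact: (measurable_step n1 fc).
- rewrite -setI_cells// => x /B01; rewrite /= in_itv/= => x01.
  by rewrite lee_fin fc.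
Qed.

Definition density (R : realType) n (A : set R) m k : R :=
  fine (leb (A `&` cell R n m k)) * n%:R ^+ m.

Lemma density_ge0 (R : realType) n (A : set R) m k : 0 <= density n A m k.
Proof. by rewrite mulr_ge0// ?exprn_ge0// fine_ge0// measure_ge0. Qed.

Lemma densityE (R : realType) n (A : set R) m k : (1 < n)%N ->
  measurable (A : set (lebesgueType R)) -> A `<=` `[0, 1[ ->
  leb (A `&` cell R n m k) = (density n A m k * n%:R ^- m)%:E.
Proof.
move=> n1 mA A01; have nm := natrX_gt0 R m n1.
rewrite /density mulfK ?lt0r_neq0// fineK// leb_fin_num//.
  by apply: measurableI => //; exact: measurable_cell.
by move=> x [/A01].
Qed.

Definition density_step (R : realType) n (A : set R) m (x : R) : R :=
  density n A m (cell_index n m x).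

Lemma saturated_setI_cell (R : realType) n m k (B : set R) : (1 < n)%N ->
  saturated n m B -> (k < n ^ m)%N ->
  cell R n m k `<=` B \/ B `&` cell R n m k = set0.
Proof.
move=> n1 [B01 Bsat] kn; have [kB|] := pselect (cell R n m k `<=` B); [by left|].
move=> nkB; right; apply/seteqP; split=> // x [Bx kx]; apply: nkB => y ky.
apply: Bsat Bx _ _; first by have := cell_sub01 n1 kn ky; rewrite /= in_itv.
by move: kx ky => /(cellP _ _ _ n1)[_ ->] /(cellP _ _ _ n1)[_ ->].
Qed.

Lemma integral_indic01 (R : realType) (A B : set R) :
  measurable (A : set (lebesgueType R)) -> measurable (B : set (lebesgueType R)) ->
  (\int[@leb R]_(x in B) (\1_A x)%:E = leb (A `&` B))%E.
Proof. by move=> mA mB; rewrite integral_indic. Qed.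

Lemma density_step_cond_exp (R : realType) n (A : set R) m : (1 < n)%N ->
  measurable (A : set (lebesgueType R)) -> A `<=` `[0, 1[ ->
  is_cond_exp (nadic_sigma R n m) \1_A (density_step n A m).
Proof.
move=> n1 mA A01; have stepE (x : R) : 0 <= x < 1 ->
    density_step n A m x = density n A m (cell_index n m x) by [].
have intE B : saturated n m B ->
    (\int[@leb R]_(x in B) (density_step n A m x)%:E = leb (A `&` B))%E.
  move=> Bsat; have mB := saturated_measurable n1 Bsat; have [B01 _] := Bsat.
  rewrite (integral_step n1 (density_ge0 n A m) stepE mB B01).
  rewrite (@leb_sum_cells _ n m (A `&` B))//; last 2 first.
  - exact: measurableI.
  - by move=> x [/A01].
  apply: eq_bigr => k _.
  have [kB|Bk0] := saturated_setI_cell n1 Bsat (ltn_ord k).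
    rewrite -setIA (setIidr kB) leb_cell// -EFinM.
    by rewrite densityE.
  by rewrite -setIA Bk0 setI0 !measure0 mule0.
rewrite /is_cond_exp nadic_sigmaE//; split.
- by move=> Y _; exact: (saturated_preimage _ stepE).
- apply/integrableP; split.
    by apply/measurable_EFinP; exact: (measurable_step n1 stepE).
  have abseE x : `|(EFin \o density_step n A m) x|%E = (density_step n A m x)%:E.
    by rewrite /= ger0_norm// density_ge0.
  under eq_integral do rewrite abseE.
  rewrite intE; last by split=> // x y _; rewrite /= in_itv.
  rewrite (setIidl A01); have := leb_fin_num mA A01.
  by rewrite ge0_fin_numE// measure_ge0.
- move=> B Bsat; rewrite intE// integral_indic01//.
  exact: saturated_measurable Bsat.
Qed.

(** [cond_exp] selects an unspecified version, but a measurable version is constant on each cell,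
    and cells have positive measure. The integral over a cell therefore fixes its value at every
    point of [0, 1), not only almost everywhere. *)
Lemma mart_indic (R : realType) n (A : set R) m (x : R) : (1 < n)%N ->
  measurable (A : set (lebesgueType R)) -> A `<=` `[0, 1[ -> 0 <= x < 1 ->
  mart n \1_A m x = density n A m (cell_index n m x).
Proof.
move=> n1 mA A01 x01; rewrite /mart /cond_exp.
have [] := @xgetPex _ (fun=> 0) [set g | is_cond_exp (nadic_sigma R n m) \1_A g].
  by exists (density_step n A m); exact: density_step_cond_exp.
set g := xget _ _; rewrite nadic_sigmaE// => gm _ gint.
have /andP[x0 x1] := x01; set k := cell_index n m x.
have kn : (k < n ^ m)%N by exact: cell_index_lt.
(* The preimage of the singleton {g x} is saturated, so it contains the whole cell of x. *)
have gk y : cell R n m k y -> g y = g x.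
  move=> ky; have [_ gs] := gm [set g x] (measurable_set1 _).
  have y01 : 0 <= y < 1 by have := cell_sub01 n1 kn ky; rewrite /= in_itv.
  have xy : cell_index n m x = cell_index n m y.
    by move: ky => /(cellP _ _ _ n1)[_ ->].
  by have [|_ ->] := gs x y _ y01 xy; first by split=> //=; rewrite in_itv.
have := gint _ (@cell_saturated R n m k n1 kn).
rewrite integral_indic01//; last exact: measurable_cell.
rewrite densityE// (_ : (\int[_]_(_ in _) _)%E = ((g x)%:E * leb (cell R n m k))%E).
  rewrite leb_cell// -EFinM => -[] /mulIf; apply.
  by rewrite invr_eq0 lt0r_neq0// natrX_gt0.
rewrite -integral_cst; last exact: measurable_cell.
by apply: eq_integral => y; rewrite inE => /gk ->.
Qed.

Lemma density_le1 (R : realType) n (A : set R) m k : (1 < n)%N ->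
  measurable (A : set (lebesgueType R)) -> A `<=` `[0, 1[ ->
  density n A m k <= 1.
Proof.
move=> n1 mA A01; have nm := natrX_gt0 R m n1.
have : (leb (A `&` cell R n m k) <= leb (cell R n m k))%E.
  apply: (le_measure (@leb R)); rewrite ?inE; last exact: subIsetr.
    by apply: measurableI => //; exact: measurable_cell.
  exact: measurable_cell.
rewrite leb_cell// densityE// lee_fin => h.
by rewrite -(@ler_pM2r _ (n%:R ^- m)) ?invr_gt0// mul1r.
Qed.

(** Martingale property: a cell is the union of [n] disjoint children of equal length. *)
Lemma density_mean (R : realType) n (A : set R) m k : (1 < n)%N ->
  measurable (A : set (lebesgueType R)) -> A `<=` `[0, 1[ ->
  density n A m k = mean (fun i : 'I_n => density n A m.+1 (k * n + i)).
Proof.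
move=> n1 mA A01; have nm := natrX_gt0 R m n1.
have n0 : (0 : R) < n%:R by rewrite ltr0n ltnW.
have := leb_cell_split m k n1 mA; rewrite densityE//.
under eq_bigr do rewrite densityE//.
rewrite sumEFin -mulr_suml exprS => -[] /(canRL (mulfVK _)).
rewrite lt0r_neq0 ?invr_gt0// => /(_ isT) ->.
by rewrite /mean; field; rewrite !lt0r_neq0.
Qed.

Lemma sum_ord_muln (V : nmodType) (f : nat -> V) N n :
  \sum_(k < N * n) f k = \sum_(k < N) \sum_(i < n) f (k * n + i)%N.
Proof.
elim: N => [|N IHN]; first by rewrite mul0n !big_ord0.
rewrite big_ord_recr /= -IHN -(big_mkord xpredT f) mulSn addnC.
rewrite (big_cat_nat (n := (N * n)%N)) ?leq_addr//= big_mkord; congr (_ + _).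
rewrite -{1}[(N * n)%N]add0n big_addn addKn big_mkord.
by under eq_bigr do rewrite addnC.
Qed.

(** * Expectation of P along the martingale and the bound by the square-free variation S_1 *)

(** This is E P(f_m) for f the indicator of [A]. *)
Definition level_mean (R : realType) n (A : set R) m : R :=
  \sum_(k < n ^ m) Pext n (density n A m k) * n%:R ^- m.

(** This is E |d_(m+1)|; the index is one less than that of the martingale difference. *)
Definition level_var (R : realType) n (A : set R) m : R :=
  \sum_(k < n ^ m.+1)
    `|density n A m.+1 k - density n A m (k %/ n)| * n%:R ^- m.+1.

(** The mean inequality is applied to the densities of the [n] children of each level-m cell and
    summed with weight n^-m. *)
Lemma level_mean_step (R : realType) n (A : set R) m : (1 < n)%N ->
  measurable (A : set (lebesgueType R)) -> A `<=` `[0, 1[ ->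
  level_mean n A m <= level_mean n A m.+1 + level_var n A m.
Proof.
move=> n1 mA A01; rewrite /level_mean /level_var expnSr.
rewrite (sum_ord_muln (fun k => Pext n (density n A m.+1 k) * n%:R ^- m.+1)).
rewrite (sum_ord_muln (fun k =>
  `|density n A m.+1 k - density n A m (k %/ n)| * n%:R ^- m.+1)).
rewrite -big_split; apply: ler_sum => k _ /=.
pose x (i : 'I_n) : R := density n A m.+1 (k * n + i).
have x01 i : `[0, 1]%classic (x i).
  by rewrite /= in_itv/= density_ge0 density_le1.
have := Pext_mean_ineq n1 x01; rewrite /x -density_mean//.
have nm := natrX_gt0 R m n1; have n0 : (0 : R) < n%:R by rewrite ltr0n ltnW.
move=> H; rewrite -!mulr_suml.
have -> : \sum_(i < n) `|density n A m.+1 (k * n + i)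
      - density n A m ((k * n + i) %/ n)|
    = \sum_(i < n) `|density n A m.+1 (k * n + i) - density n A m k|.
  apply: eq_bigr => i _.
  by rewrite divnMDl ?(ltnW n1)// divn_small// addn0.
rewrite ler_pdivrMr// (le_trans H)// exprS.
rewrite le_eqVlt; apply/orP; left; apply/eqP; field.
by rewrite !lt0r_neq0.
Qed.

Lemma integral_mart_diff (R : realType) n (A : set R) m : (1 < n)%N ->
  measurable (A : set (lebesgueType R)) -> A `<=` `[0, 1[ ->
  (\int[@leb R]_(x in `[0%R, 1%R[) `|mart n \1_A m.+1 x - mart n \1_A m x|%:E
   = (level_var n A m)%:E)%E.
Proof.
move=> n1 mA A01.
pose c k : R := `|density n A m.+1 k - density n A m (k %/ n)|.
rewrite (@integral_step _ n m.+1 c)//.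
- rewrite /level_var -sumEFin; apply: eq_bigr => k _.
  by rewrite (setIidr (cell_sub01 n1 (ltn_ord k))) leb_cell.
- by move=> k; exact: normr_ge0.
- move=> x x01; rewrite !mart_indic// [cell_index n m x]cell_index_divn//.
  by case/andP: x01.
- exact: measurable_itv01.
Qed.

Lemma norm1_S1_ge (R : realType) n (A : set R) M : (1 < n)%N ->
  measurable (A : set (lebesgueType R)) -> A `<=` `[0, 1[ ->
  ((\sum_(m < M) level_var n A m)%:E <= norm1 (S1 n \1_A))%E.
Proof.
move=> n1 mA A01; rewrite /norm1.
pose d m (x : R) := `|mart n \1_A m.+1 x - mart n \1_A m x|%:E.
have S1E x : `|S1 n \1_A x|%E = (\sum_(0 <= m <oo) d m x)%E.
  rewrite gee0_abs; last by apply: nneseries_ge0 => *; rewrite lee_fin.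
  rewrite /S1 -nneseries_addn; last by move=> i; rewrite lee_fin.
  by under eq_eseriesr do rewrite addn1.
under eq_integral do rewrite S1E.
have md m : @measurable_fun _ _ (lebesgueType R) _ (`[0, 1[%classic : set R) (d m).
  pose c k := `|density n A m.+1 k - density n A m (k %/ n)|%:E.
  apply: (@measurable_step _ n m.+1 _ _ c) => // x x01.
  rewrite /d /c !mart_indic// [cell_index n m x]cell_index_divn//.
  by case/andP: x01.
rewrite integral_nneseries//; last by move=> *; rewrite lee_fin.
  2: exact: measurable_itv01.
under eq_eseriesr do rewrite integral_mart_diff//.
rewrite -sumEFin -(big_mkord xpredT (fun m => (level_var n A m)%:E)).
apply: nneseries_lim_ge => m _.
by rewrite lee_fin sumr_ge0// => k _; rewrite mulr_ge0// invr_ge0 exprn_ge0.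
Qed.

(** * Approximation of measurable sets and the final estimate *)

(** A Lebesgue set is a Borel set [X] together with a subset of a Borel null set [F]. Outer
    regularity of the Borel set X U F yields an open cover, and adjoining [F] to the excess costs no
    measure. *)
Lemma leb_outer_open (R : realType) (A : set R) (e : R) :
  measurable (A : set (lebesgueType R)) -> A `<=` `[0, 1[ -> 0 < e ->
  exists U : set R, [/\ open U, A `<=` U & (leb (U `\` A) < e%:E)%E].
Proof.
move=> mA A01 e0.
have : (completed_algebra_gen (@lebesgue_measure R)).-sigma.-measurable A.
  by rewrite completed_caratheodory_measurable.
rewrite g_sigma_completed_algebra_genE => -[X mX [N [F [mF F0 NF]]] XN].
have mXF : measurable (X `|` F) by exact: measurableU.
have muXF : (lebesgue_measure (X `|` F) < +oo)%E.
  apply: (@le_lt_trans _ _ (leb A)); last first.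
    by have := leb_fin_num mA A01; rewrite ge0_fin_numE// measure_ge0.
  rewrite measureU0//; apply: (le_outer_measure (wlength idfun)^*%mu).
  by rewrite -XN; exact: subsetUl.
have [U [oU XFU UXF]] := lebesgue_regularity_outer mXF muXF e0.
have cF (Y : set R) : measurable Y -> measurable (Y : set (lebesgueType R)).
  by move=> mY; exact: sub_caratheodory.
have mU : measurable U by exact: open_measurable.
exists U; split=> //.
  by rewrite -XN; apply: subset_trans XFU => x [Xx|/NF Fx]; [left|right].
have mUXF : measurable (U `\` (X `|` F)) by exact: measurableD.
apply: (@le_lt_trans _ _ (leb (U `\` (X `|` F) `|` F))).
  apply: (le_measure (@leb R)); rewrite ?inE.
  - by apply: measurableD => //; exact: cF.
  - by apply: cF; exact: measurableU.
  - move=> x [Ux nAx]; have [Fx|nFx] := pselect (F x); first by right.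
    by left; split=> // -[Xx|//]; apply: nAx; rewrite -XN; left.
rewrite measureU0//; first exact: cF.
exact: cF.
Qed.

(** Near 0 continuity and P(0) = 0 give P <= e; at distance [d] or more, P <= 2 <= (2/d)t. Symmetry
    covers the other half. The linear bound transfers smallness of E min(f_M, 1 - f_M) to E
    P(f_M). *)
Lemma Pext_le_min (R : realType) n (e : R) : (1 < n)%N -> 0 < e ->
  exists2 C : R, 0 < C &
    forall t, 0 <= t <= 1 -> Pext n t <= e + C * Num.min t (1 - t).
Proof.
move=> n1 e0; have Pc := @Pext_continuous R n n1 0.
have P0 : Pext n (0 : R) = 0 by exact: (Pext_nat R n 0).
have /cvgrPdist_lt/(_ e e0) := Pc; rewrite P0 => -[d /= d0 dP].
have near0 t : 0 <= t < d -> Pext n t <= e.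
  move=> /andP[t0 td]; have := dP t; rewrite /= !sub0r !normrN ger0_norm// => /(_ td).
  by rewrite ger0_norm ?Pext_ge0//; exact: ltW.
exists (2 / d); first by rewrite divr_gt0.
have low t : 0 <= t -> Pext n t <= e + 2 / d * t.
  move=> t0; have [td|td] := ltP t d.
    have : Pext n t <= e by rewrite near0// t0.
    have : 0 <= 2 / d * t by rewrite mulr_ge0// divr_ge0// ltW.
    lra.
  have : 2 <= 2 / d * t by rewrite mulrAC ler_pdivlMr//; lra.
  have := Pext_le2 t n1; lra.
move=> t /andP[t0 t1].
have [_|_] := leP t (1 - t); first exact: low.
by rewrite -(Pext_onem n t) low// subr_ge0.
Qed.

(* Cover A by an open U with |U \ A| small; the union V of the level-M cells
   contained in U exhausts U.  A cell inside U contributes at most its part of U \ A,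
   any other cell at most its part of U \ V. *)
Lemma level_min_small (R : realType) n (A : set R) (e : R) : (1 < n)%N ->
  measurable (A : set (lebesgueType R)) -> A `<=` `[0, 1[ -> 0 < e ->
  exists M, \sum_(k < n ^ M)
    Num.min (density n A M k) (1 - density n A M k) * n%:R ^- M <= e.
Proof.
move=> n1 mA A01 e0.
have [|U [oU AU UA]] := @leb_outer_open _ A (e / 2) mA A01; first by rewrite divr_gt0.
have mU : measurable (U : set (lebesgueType R)).
  by apply: sub_caratheodory; exact: open_measurable.
pose V m : set R := [set x | 0 <= x < 1 /\ cell R n m (cell_index n m x) `<=` U].
have Vsat m : saturated n m (V m).
  split; first by move=> x [x01 _]; rewrite /= in_itv.
  by move=> x y [x01 xU] y01 xy; split => //; rewrite -xy.
have mV m : measurable (V m : set (lebesgueType R)).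
  exact: saturated_measurable (Vsat m).
pose W : set R := U `&` `[0, 1[.
have mW : measurable (W : set (lebesgueType R)).
  by apply: measurableI => //; exact: measurable_itv01.
have VW m : V m `<=` W.
  move=> x [x01 xU]; split; last by rewrite /= in_itv.
  by apply: xU; apply/cellP => //; case/andP: x01.
have bigV : \bigcup_m V m = W.
  apply/seteqP; split => [x [m _]|x [Ux]]; first exact: VW.
  rewrite /= in_itv/= => /andP[x0 x1].
  have /nbhs_ballP[d /= d0 dU] := open_nbhs_nbhs (conj oU Ux).
  (* The level is taken so fine that the cell of x is shorter than [d] and hence lies in the ball
     around x inside [U]. *)
  have [|m _ /(_ m (leqnn m)) /= md] := cvgr_lt 0 (@cvg_natrVX R n n1) d; first by [].
  exists m => //; split; first by rewrite x0.
  have : cell R n m (cell_index n m x) x by apply/cellP.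
  rewrite /cell /= in_itv/= -natr1 mulrDl mul1r => /andP[x2 x3] y.
  rewrite /= in_itv/= => /andP[y2 y3].
  by apply: dU; rewrite /ball/= ltr_norml; lra.
have nV : {homo V : p q / (p <= q)%N >-> (p <= q)%O}.
  apply/nondecreasing_seqP => m; apply/subsetPset => x [/andP[x0 x1] xU].
  split; first by rewrite x0.
  apply: subset_trans xU => y /(cellP _ _ _ n1)[y0 yx]; apply/cellP => //; split=> //.
  by rewrite !(cell_index_divn m)// yx.
have fV m : leb (V m) \is a fin_num by apply: leb_fin_num => // x /VW[].
have fW : leb W \is a fin_num by apply: leb_fin_num => // x [].
have [M WV] : exists M, (leb (W `\` V M) <= (e / 2)%:E)%E.
  have muV : leb \o V @ \oo --> leb W.
    rewrite -bigV; apply: (nondecreasing_cvg_mu (mu := @leb R)) => //.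
    by rewrite bigV.
  have {muV} : (fun m => fine (leb (V m))) @ \oo --> fine (leb W).
    by apply: fine_cvg; rewrite fineK.
  move=> /cvgrPdist_le/(_ (e / 2)); rewrite divr_gt0// => /(_ isT).
  move=> [M _ /(_ M (leqnn M)) /=] /ler_normlP[_ h]; exists M.
  have hE : (leb W - leb (V M) <= (e / 2)%:E)%E.
    by rewrite -(fineK fW) -(fineK (fV M)) -EFinB lee_fin.
  rewrite (measureD (mu := @leb R))//; last by rewrite -ge0_fin_numE.
  by rewrite (setIidr (VW M)); exact: hE.
(* [Q] gathers both losses, each of measure at most e/2. The minimum on each cell is then bounded by
   the measure of [Q] in that cell. *)
exists M; pose Q : set R := ((U `\` A) `&` `[0, 1[) `|` (W `\` V M).
have mUA : measurable (U `\` A : set (lebesgueType R)) by exact: measurableD.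
have mUA1 : measurable ((U `\` A) `&` `[0, 1[ : set (lebesgueType R)).
  by apply: measurableI => //; exact: measurable_itv01.
have mWV : measurable (W `\` V M : set (lebesgueType R)) by exact: measurableD.
have mQ : measurable (Q : set (lebesgueType R)) by exact: measurableU.
have Q01 : Q `<=` `[0, 1[ by move=> x [[_ //]|[[_ //]]].
have Qe : (leb Q <= e%:E)%E.
  have := measureU2 (@leb R) mUA1 mWV => /le_trans; apply.
  rewrite [e]splitr EFinD leeD//; apply: ltW; apply: le_lt_trans UA.
  by apply: (le_measure (@leb R)); rewrite ?inE//; exact: subIsetl.
rewrite -lee_fin -sumEFin (le_trans _ Qe)// (leb_sum_cells M n1 mQ Q01).
apply: lee_sum => k _; have nM := natrX_gt0 R M n1.
have mk : measurable (cell R n M k : set (lebesgueType R)) by exact: measurable_cell.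
have mQk : measurable (Q `&` cell R n M k : set (lebesgueType R)) by exact: measurableI.
have mAk : measurable (A `&` cell R n M k : set (lebesgueType R)) by exact: measurableI.
have [kU|nkU] := pselect (cell R n M k `<=` U).
  apply: (@le_trans _ _ (leb (cell R n M k `\` A))); last first.
    apply: (le_measure (@leb R)); rewrite ?inE//; first exact: measurableD.
    move=> x [kx nAx]; split=> //; left; split; first by split=> //; exact: kU.
    exact: (cell_sub01 n1 (ltn_ord k)).
  rewrite (measureD (mu := @leb R))//; last first.
    by apply: (@le_lt_trans _ _ (n%:R ^- M)%:E); [rewrite -(leb_cell R M k n1)|exact: ltry].
  rewrite setIC.
  suff : ((Num.min (density n A M k) (1 - density n A M k) / n%:R ^+ M)%:E
      <= leb (cell R n M k) - leb (A `&` cell R n M k))%E by exact.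
  rewrite leb_cell// densityE// -EFinB lee_fin -[X in _ <= X - _]mul1r -mulrBl.
  by rewrite ler_pM2r ?invr_gt0// ge_min lexx orbT.
apply: (@le_trans _ _ (leb (A `&` cell R n M k))).
  by rewrite densityE// lee_fin ler_pM2r ?invr_gt0// ge_min lexx.
apply: (le_measure (@leb R)); rewrite ?inE//.
move=> x [Ax kx]; split=> //; right; split; first by split; [exact: AU|exact: A01].
by case=> _; move: kx => /(cellP _ _ _ n1)[_ ->].
Qed.

Lemma level_mean_small (R : realType) n (A : set R) (e : R) : (1 < n)%N ->
  measurable (A : set (lebesgueType R)) -> A `<=` `[0, 1[ -> 0 < e ->
  exists M, level_mean n A M <= e.
Proof.
move=> n1 mA A01 e0; have e20 : 0 < e / 2 by rewrite divr_gt0.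
have [C C0 PC] := Pext_le_min n1 e20.
have [|M HM] := @level_min_small _ n A (e / 2 / C) n1 mA A01.
  by rewrite divr_gt0.
exists M; have nM := natrX_gt0 R M n1; rewrite /level_mean.
apply: (@le_trans _ _ (\sum_(k < n ^ M) (e / 2 * n%:R ^- M
  + C * (Num.min (density n A M k) (1 - density n A M k) * n%:R ^- M)))).
  apply: ler_sum => k _; rewrite mulrA -mulrDl ler_pM2r ?invr_gt0//.
  by apply: PC; rewrite density_ge0 density_le1.
have sumc : \sum_(k < n ^ M) (e / 2 * n%:R ^- M) = e / 2.
  by rewrite sumr_const card_ord -[_ *+ _]mulr_natr natrX mulfVK// lt0r_neq0.
rewrite big_split /= sumc -mulr_sumr.
by rewrite [leRHS]splitr lerD2l -ler_pdivlMl// mulrC.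
Qed.

Lemma Pext_le_norm1_S1 (R : realType) n (A : set R) : (1 < n)%N ->
  measurable (A : set (lebesgueType R)) -> A `<=` `[0, 1[ ->
  ((Pext n (star (fine (leb A))))%:E <= norm1 (S1 n \1_A))%E.
Proof.
move=> n1 mA A01.
(* Level 0 has the single cell [0, 1) with density |A|; passing to [star] is harmless by the
   symmetry of P. *)
have -> : Pext n (star (fine (leb A))) = level_mean n A 0.
  rewrite /level_mean expn0 big_ord1 expr0 invr1 mulr1 /density mulr1.
  rewrite (_ : A `&` _ = A); last first.
    by apply/setIidPl; apply: subset_trans A01 _; rewrite /cell expr0 !divr1.
  by rewrite /star; case: leP => // _; rewrite Pext_onem.
apply/lee_addgt0Pr => e e0; have [M HM] := level_mean_small n1 mA A01 e0.
apply: le_trans (leeD (norm1_S1_ge M n1 mA A01) (lexx _)).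
rewrite -EFinD lee_fin.
(* Iterating [level_mean_step] from level 0 to level M. *)
apply: le_trans (_ : \sum_(m < M) level_var n A m + level_mean n A M <= _).
  elim: (M) => [|p IHp]; first by rewrite big_ord0 add0r.
  rewrite big_ord_recr /= (le_trans IHp)// -addrA lerD2l addrC.
  exact: level_mean_step.
by rewrite lerD2l.
Qed.

Theorem theorem2p7 (R : realType) (n : nat) (hn : (2 <= n)%N) :
  (* (1) *)
  (forall (m0 : nat) (x : R), nadic_level R n m0 x ->
     forall m : nat, (m0 <= m)%N -> Blevel n m x = Blevel n m0 x) /\
  (forall x : R, nadic R n x -> cvgn (fun m => Blevel n m x)) /\
  (* (2) *)
  (Pnadic n (0 : R) = 0 /\ Pnadic n (1 : R) = 0) /\
  (* (3) *)
  mean_ineq n (nadic R n) (Pnadic n) /\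
  exists P : R -> R,
    (* (4) *)
    {within `[0, 1], continuous P} /\
    (forall x : R, nadic R n x -> P x = Pnadic n x) /\
    classB11 n P /\
    (forall A : set R, measurable (A : set (lebesgueType R)) ->
       A `<=` `[0, 1[ ->
       ((P (star (fine (leb A))))%:E <= norm1 (S1 n \1_A))%E) /\
    (* (5) *)
    (exists eta : R -> R, is_eta n eta /\
       forall x : R, x \in `[0, 1] ->
         series (fun j => n%:R ^- j * eta (fracpart (n%:R ^+ j * x)))
           @ \oo --> P x) /\
    (* (6) *)
    (forall x : R, x \in `[0, 1] -> P (1 - x) = P x) /\
    (* (7) *)
    (exists c C : R, [/\ 0 < c, c <= C &
       forall x : R, x \in `]0, 1[ ->
         c * (star x * ln (1 / star x)) <= P x /\
         P x <= C * (star x * ln (1 / star x))]).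
Proof.
split.
  move=> m0 x xm0 m m0m; rewrite -(Pext_nadic_level hn xm0).
  by rewrite -(Pext_nadic_level hn (nadic_level_leq (ltnW hn) m0m xm0)).
split; first by move=> x /(cvg_Blevel hn) cx; apply/cvg_ex; exists (Pext n x).
have N0 : nadic R n 0 by exists 0%N => //; exists 0%N => //; rewrite mul0r.
have N1 : nadic R n 1 by exists 0%N => //; exists 1%N => //; rewrite divr1.
split; first by rewrite !Pnadic_Pext// (Pext_nat R n 0) (Pext_nat R n 1).
split; first exact: Pnadic_mean_ineq.
exists (Pext n); split; first exact/continuous_subspaceT/Pext_continuous.
split; first by move=> x /(Pnadic_Pext hn).
split; first exact: Pext_classB11.
split; first by move=> A mA A01; exact: Pext_le_norm1_S1.
split.
  exists (eta_fun n); split; first exact: is_eta_eta_fun.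
  by move=> x _; exact: cvg_sum_eta_fun.
split; first by move=> x _; exact: Pext_onem.
have [c [C [c0 cC bounds]]] := @Pext_log_bounds R n hn.
exists c, C; split=> // x; rewrite in_itv/= => /andP[x0 x1].
(* Symmetry reduces the bounds to [star x], which lies in (0, 1/2]. *)
have -> : Pext n x = Pext n (star x).
  by rewrite /star; case: leP => // _; rewrite Pext_onem.
apply/andP; apply: bounds; rewrite /star.
by case: (leP x (1 - x)) => x2; apply/andP; split; lra.
Qed.
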